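(* Let $G$ be a loopless multigraph on $[n]$ and let $F_1,\ldots,F_l$ be the full dimensional leaves of the reduction tree $R_G^{\mathcal{O}}$, listed in depth-first search order. Then $\mathcal{F}_{\widetilde{F_1}},\ldots,\mathcal{F}_{\widetilde{F_l}}$ is a shelling order of the canonical triangulation of $\mathcal{F}_{\widetilde{G}}$.
   Context: Graphs are finite loopless multigraphs on $[n]$, edges written $(i,j)$ with $i<j$. Reduction on edges $a=(i,j)$, $b=(j,k)$, $i<j<k$, of $G$ produces $G_1$ ($E(G)\setminus\{b\}\cup\{(i,k)\}$), $G_2$ ($E(G)\setminus\{a\}\cup\{(i,k)\}$), $G_3$ ($E(G)\setminus\{a,b\}\cup\{(i,k)\}$), the new edge $(i,k)$ being formally the sum $a+b$. A reduction tree of $G$ is a rooted tree of graphs with root $G$, each non-leaf node $H$ having three children obtained by one reduction, ordered left to right as $H_1$ (left), $H_3$ (middle), $H_2$ (right); leaves are the graphs with no pair $(i,j),(j,k)$, $i<j<k$. Every edge of every node is thus a formal sum of edges of $G$ (edges of $G$ distinguished), and edges of different nodes are equal iff they are sums of the same edges of $G$. A leaf is full dimensional if it has $|E(G)|$ edges. Depth-first search order lists leaves of the left subtree, then the middle, then the right, recursively. Order $\mathcal{O}$: at a non-leaf node, take the smallest vertex $v$ having edges $(a,v)$, $a<v$, and $(v,b)$, $b>v$, and reduce on such edges with $a$ minimal and $b$ maximal; this gives $R_G^{\mathcal{O}}$. $\widetilde G$ is $G$ with a new smallest vertex $s$ and largest vertex $t$ and edges $(s,i),(i,t)$ for all $i\in[n]$;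 $\mathcal{F}_{\widetilde G}$ is the polytope of nonnegative flows on $\widetilde G$ with net outflow $1$ at $s$, inflow $1$ at $t$ and conservation at all $i\in[n]$. For a node $H$, an edge $(v_1,v_2)=e_{i_1}+\cdots+e_{i_l}$ of $H$ determines the route $(s,v_1),e_{i_1},\dots,e_{i_l},(v_2,t)$, and $\mathcal{F}_{\widetilde H}$ is the convex hull of the unit flows along these routes. The simplices $\mathcal{F}_{\widetilde{F_i}}$ for the full dimensional leaves form a triangulation of $\mathcal{F}_{\widetilde G}$, called the canonical triangulation. A shelling order of a triangulation with top-dimensional simplices $\sigma_1,\dots,\sigma_l$ is one in which, for each $i\ge 2$, $\sigma_i\cap(\sigma_1\cup\dots\cup\sigma_{i-1})$ is a nonempty union of facets of $\sigma_i$.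
   Formalization: Ties between parallel edges in the order O are broken by fixed linear orders on formal sums compatible with addition (arbitrary tie-breaking can fail to give a triangulation), and the vertices of each leaf simplex also include the routes (s,i),(i,t). *)

(* Defs.v *)
From HB Require Import structures.
From mathcomp Require Import all_boot all_order all_algebra.
From mathcomp Require Import boolp classical_sets.
Set Implicit Arguments.
Unset Strict Implicit.
Unset Printing Implicit Defensive.
Import Order.TTheory GRing.Theory Num.Theory.

Record multigraph (n : nat) := Multigraph {
  edge : finType;
  src : edge -> 'I_n;
  tgt : edge -> 'I_n;
  src_lt_tgt : forall e, src e < tgt e }.

Section ReductionTrees.
Variables (n : nat) (G : multigraph n).

(* An edge (i, k) of a node of a reduction tree, together with the set A of
   the edges of G of which it is the formal sum, is the triple (i, k, A).  The
   summands form a directed path from i to k, so none of them is repeated. *)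
Definition hedge := ('I_n * 'I_n * {set edge G})%type.
Definition hsrc (h : hedge) : 'I_n := h.1.1.
Definition htgt (h : hedge) : 'I_n := h.1.2.
Definition hsum (h : hedge) : {set edge G} := h.2.

(* Parallel edges of a node are different formal sums (a reduction keeps the
   formal sums in a node linearly independent), so a plain set suffices. *)
Definition node := {set hedge}.

Definition root_node : node := [set (src e, tgt e, [set e]) | e : edge G].

Definition reducible (H : node) (a b : hedge) : bool :=
  [&& a \in H, b \in H, hsrc a < htgt a, htgt a == hsrc b & hsrc b < htgt b].

Definition new_edge (a b : hedge) : hedge :=
  (hsrc a, htgt b, hsum a :|: hsum b).

Definition red1 (H : node) (a b : hedge) : node := new_edge a b |: (H :\ b).
Definition red2 (H : node) (a b : hedge) : node := new_edge a b |: (H :\ a).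
Definition red3 (H : node) (a b : hedge) : node :=
  new_edge a b |: (H :\ a :\ b).

(* [Node H l m r]: the children are listed from left to right. *)
Inductive rtree := Leaf of node | Node of node & rtree & rtree & rtree.

Inductive reduction_tree (rule : node -> hedge -> hedge -> Prop) :
    node -> rtree -> Prop :=
| RTLeaf H : (forall a b, ~~ reducible H a b) -> reduction_tree rule H (Leaf H)
| RTNode H a b T1 T3 T2 : reducible H a b -> rule H a b ->
    reduction_tree rule (red1 H a b) T1 ->
    reduction_tree rule (red3 H a b) T3 ->
    reduction_tree rule (red2 H a b) T2 ->
    reduction_tree rule H (Node H T1 T3 T2).

Fixpoint leaves (T : rtree) : seq node :=
  match T with
  | Leaf H => [:: H]
  | Node _ l m r => leaves l ++ leaves m ++ leaves r
  end.

Definition full_leaves (T : rtree) : seq node :=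
  [seq H : node <- leaves T | #|H| == #|edge G|].

(* Linear orders on formal sums that are compatible with addition; they serve
   to break ties between parallel edges.  Example: compare the numbers
   \sum_(e in A) 2 ^ r e, where r is an injective numbering of the edges. *)
Definition additive_order (le : rel {set edge G}) : Prop :=
  [/\ total le, antisymmetric le, transitive le &
      forall A B C : {set edge G}, [disjoint A & C] -> [disjoint B & C] ->
        le A B -> le (A :|: C) (B :|: C)].

Variables lei leo : rel {set edge G}.

Definition in_le (a a' : hedge) : bool :=
  (hsrc a < hsrc a') || ((hsrc a == hsrc a') && lei (hsum a) (hsum a')).
Definition out_le (b b' : hedge) : bool :=
  (htgt b' < htgt b) || ((htgt b == htgt b') && leo (hsum b) (hsum b')).

(* The order O.  "The" edge (a, v) with a minimal is not determined when there
   are parallel edges; [lei] selects one, and [leo] selects the edge (v, b).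
   The orders do not depend on the node: otherwise different branches could
   subdivide a common face differently. *)
Definition ruleO (H : node) (a b : hedge) : Prop :=
  forall a' b', reducible H a' b' ->
    htgt a <= htgt a' /\ (htgt a' = htgt a -> in_le a a' /\ out_le b b').

Definition reduction_treeO : rtree -> Prop := reduction_tree ruleO root_node.

End ReductionTrees.

Section ReductionTreeO.
Variables (n : nat) (G : multigraph n) (lei leo : rel {set edge G}).
Hypotheses (lei_add : additive_order lei) (leo_add : additive_order leo).

Let le_in := in_le (G := G) lei.
Let le_out := out_le (G := G) leo.

Let le_in_total : total le_in.
Proof.
move=> a b; rewrite /le_in /in_le.
case: ltngtP => [_|_|/ord_inj ->] /=; rewrite ?orbT // eqxx /=.
by case: lei_add => + _ _ _; apply.
Qed.

Let le_in_trans : transitive le_in.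
Proof.
have [_ _ tr _] := lei_add.
move=> b a c /orP[ab|/andP[/eqP ab lab]] /orP[bc|/andP[/eqP bc lbc]].
- by rewrite /le_in /in_le (ltn_trans ab bc).
- by rewrite /le_in /in_le -bc ab.
- by rewrite /le_in /in_le ab bc.
- by rewrite /le_in /in_le ab bc eqxx (tr _ _ _ lab lbc) orbT.
Qed.

Let le_out_total : total le_out.
Proof.
move=> a b; rewrite /le_out /out_le.
case: ltngtP => [_|_|/ord_inj ->] /=; rewrite ?orbT // eqxx /=.
by case: leo_add => + _ _ _; apply.
Qed.

Let le_out_trans : transitive le_out.
Proof.
have [_ _ tr _] := leo_add.
move=> b a c /orP[ab|/andP[/eqP ab lab]] /orP[bc|/andP[/eqP bc lbc]].
- by rewrite /le_out /out_le (ltn_trans bc ab).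
- by rewrite /le_out /out_le -bc ab.
- by rewrite /le_out /out_le ab bc.
- by rewrite /le_out /out_le ab bc eqxx (tr _ _ _ lab lbc) orbT.
Qed.

Let seq_min (T : eqType) (le : rel T) (s : seq T) (x0 : T) :
  total le -> transitive le -> x0 \in s ->
  exists2 x, x \in s & {in s, forall y, le x y}.
Proof.
move=> tot tr; elim: s x0 => [|x s IH] x0 // _.
have rf z : le z z by have := tot z z; rewrite orbb.
case: s IH => [|y s] IH.
  by exists x; rewrite ?mem_head // => z; rewrite inE => /eqP ->.
have [m ms mP] := IH y (mem_head _ _).
have [xm|mx] := orP (tot x m).
  exists x; first exact: mem_head.
  by move=> z; rewrite in_cons => /orP[/eqP ->|/mP]; [exact: rf|exact: tr].
exists m; first by rewrite in_cons ms orbT.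
by move=> z; rewrite in_cons => /orP[/eqP ->|/mP].
Qed.

Lemma ruleO_exists (H : node G) a b : reducible H a b ->
  exists a' b', reducible H a' b' /\ ruleO lei leo H a' b'.
Proof.
move=> rab.
pose s := [seq p <- enum [set: hedge G * hedge G] | reducible H p.1 p.2].
have sP p : (p \in s) = reducible H p.1 p.2.
  by rewrite mem_filter mem_enum inE andbT.
have ab_s : (a, b) \in s by rewrite sP.
have [||p ps pP] := seq_min
  (le := fun p q : hedge G * hedge G => htgt p.1 <= htgt q.1) _ _ ab_s.
- by move=> p q; exact: leq_total.
- by move=> p q r; exact: leq_trans.
pose sv := [seq q <- s | htgt q.1 == htgt p.1].
have svP q : (q \in sv) = reducible H q.1 q.2 && (htgt q.1 == htgt p.1).
  by rewrite mem_filter sP andbC.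
have p_sv : p \in sv by rewrite svP eqxx andbT -sP.
have [||q qs qP] := seq_min
  (le := fun p q : hedge G * hedge G => le_in p.1 q.1) _ _ p_sv.
- by move=> x y; exact: le_in_total.
- by move=> x y z; exact: le_in_trans.
have [||r rs rP] := seq_min
  (le := fun p q : hedge G * hedge G => le_out p.2 q.2) _ _ p_sv.
- by move=> x y; exact: le_out_total.
- by move=> x y z; exact: le_out_trans.
move: (qs) (rs); rewrite !svP => /andP[redq /eqP tq] /andP[redr /eqP tr].
exists q.1, r.2; split.
  move: redq redr => /and5P[q1 _ q2 _ _] /and5P[_ r1 _ /eqP r2 r3].
  by apply/and5P; split=> //; rewrite tq -tr r2.
move=> a' b' rab'; split.
  by rewrite tq; apply: (pP (a', b')); rewrite sP.
rewrite tq => tab'.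
by split; [apply: (qP (a', b'))|apply: (rP (a', b'))]; rewrite svP rab' tab' /=.
Qed.

Lemma ruleO_unique (H : node G) a b a' b' :
  reducible H a b -> ruleO lei leo H a b ->
  reducible H a' b' -> ruleO lei leo H a' b' -> a = a' /\ b = b'.
Proof.
have [_ anti _ _] := lei_add; have [_ anto _ _] := leo_add.
move=> r R r' R'; have [le1 I1] := R _ _ r'; have [le2 I2] := R' _ _ r.
have tt : htgt a = htgt a' by apply/ord_inj/eqP; rewrite eqn_leq le1.
move: (r) (r') => /and5P[_ _ _ /eqP ab _] /and5P[_ _ _ /eqP ab' _].
have [[i1 o1] [i2 o2]] := (I1 (esym tt), I2 tt).
have ss : hsrc b = hsrc b' by rewrite -ab -ab'.
split.
- have [E S] : hsrc a = hsrc a' /\ hsum a = hsum a'.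
    move: i1 i2 => /orP[lt|/andP[/eqP E l1]] /orP[lt'|/andP[/eqP E' l2]].
    + by have := ltn_trans lt lt'; rewrite ltnn.
    + by rewrite E' ltnn in lt.
    + by rewrite E ltnn in lt'.
    + by split=> //; apply: anti; rewrite l1.
  by move: E S tt; case: (a) (a') => [[? ?] ?] [[? ?] ?];
     rewrite /hsrc /htgt /hsum /= => -> -> ->.
- have [E S] : htgt b = htgt b' /\ hsum b = hsum b'.
    move: o1 o2 => /orP[lt|/andP[/eqP E l1]] /orP[lt'|/andP[/eqP E' l2]].
    + by have := ltn_trans lt lt'; rewrite ltnn.
    + by rewrite E' ltnn in lt.
    + by rewrite E ltnn in lt'.
    + by split=> //; apply: anto; rewrite l1.
  by move: E S ss; case: (b) (b') => [[? ?] ?] [[? ?] ?];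
     rewrite /hsrc /htgt /hsum /= => -> -> ->.
Qed.

Let size_edge (h : hedge G) := n - (htgt h - hsrc h).
Let weight (H : node G) := \sum_(h in H) size_edge h.

Let weightU c (H : node G) : weight (c |: H) <= size_edge c + weight H.
Proof.
rewrite /weight; have [cH|cH] := boolP (c \in H).
  by rewrite (finset.setUidPr _) ?finset.sub1set // leq_addl.
by rewrite big_setU1.
Qed.

Let weightD c (H : node G) : c \in H -> weight H = size_edge c + weight (H :\ c).
Proof. by move=> cH; rewrite /weight (big_setD1 c). Qed.

Let weight_red (H : node G) a b : reducible H a b ->
  [/\ weight (red1 H a b) < weight H, weight (red2 H a b) < weight H &
      weight (red3 H a b) < weight H].
Proof.
case/and5P=> aH bH ltia /eqP E ltbk; rewrite -E in ltbk.
have ltk := ltn_ord (htgt b).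
have sa : size_edge (new_edge a b) < size_edge a.
  rewrite /size_edge /new_edge /= ltn_sub2l //.
    exact: leq_ltn_trans (leq_subr _ _) (ltn_ord _).
  by rewrite ltn_sub2r // (ltn_trans ltia).
have sb : size_edge (new_edge a b) < size_edge b.
  rewrite /size_edge /new_edge /= -E ltn_sub2l //.
    exact: leq_ltn_trans (leq_subr _ _) ltk.
  by rewrite ltn_sub2l // (ltn_trans ltia).
split.
- by apply: leq_ltn_trans (weightU _ _) _; rewrite (weightD bH) ltn_add2r.
- by apply: leq_ltn_trans (weightU _ _) _; rewrite (weightD aH) ltn_add2r.
- apply: leq_ltn_trans (weightU _ _) _; rewrite (weightD aH).
  rewrite -addSn leq_add // /weight [leqLHS]big_mkcond [leqRHS]big_mkcond /=.
  by apply: leq_sum => h _; rewrite !inE; case: (h == b).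
Qed.

Lemma reduction_treeO_exists : exists T, reduction_treeO lei leo T.
Proof.
rewrite /reduction_treeO; move: (root_node G) => H.
have [m] := ubnP (weight H); elim: m H => // m IH H /ltnSE leHm.
have [/existsP[a /existsP[b rab]]|nred] :=
    boolP [exists a, exists b, reducible H a b]; last first.
  exists (Leaf H); apply: RTLeaf => a b; apply: contra nred => rab.
  by apply/existsP; exists a; apply/existsP; exists b.
have {a b rab}[a [b [rab Rab]]] := ruleO_exists rab.
have [w1 w2 w3] := weight_red rab.
have [T1 t1] := IH _ (leq_trans w1 leHm).
have [T2 t2] := IH _ (leq_trans w2 leHm).
have [T3 t3] := IH _ (leq_trans w3 leHm).
by exists (Node H T1 T3 T2); apply: (RTNode rab).
Qed.

Lemma reduction_treeO_unique T T' :
  reduction_treeO lei leo T -> reduction_treeO lei leo T' -> T = T'.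
Proof.
rewrite /reduction_treeO => tT; elim: tT T' => {T} [H nred|H a b T1 T3 T2].
  move=> T' tT'; case: tT' nred => // H' a b T1 T3 T2 rab _ _ _ _.
  by move=> /(_ a b); rewrite rab.
move=> rab Rab _ IH1 _ IH3 _ IH2 T' tT'.
case: tT' rab Rab IH1 IH3 IH2 => [H' nred|H' a' b' T1' T3' T2' rab' Rab' t1 t3 t2].
  by move=> rab; have := nred a b; rewrite rab.
move=> rab Rab.
have [-> ->] := ruleO_unique rab Rab rab' Rab'.
by move=> /(_ _ t1)-> /(_ _ t3)-> /(_ _ t2)->.
Qed.

End ReductionTreeO.

Section Polytopes.
Local Open Scope ring_scope.
Local Open Scope classical_set_scope.
Variables (R : realFieldType) (V : lmodType R).

Definition conv (X : seq V) : set V :=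
  [set x | exists c : V -> R, [/\ forall y, y \in X -> 0 <= c y,
     \sum_(y <- X) c y = 1 & x = \sum_(y <- X) c y *: y]].

Definition aff (X : seq V) : set V :=
  [set x | exists c : V -> R,
     \sum_(y <- X) c y = 1 /\ x = \sum_(y <- X) c y *: y].

Definition aff_indep (X : seq V) : Prop :=
  uniq X /\ forall c : V -> R,
    \sum_(y <- X) c y = 0 -> \sum_(y <- X) c y *: y = 0 ->
    forall y, y \in X -> c y = 0.

(* The vertex set X of a simplex conv X is determined by the simplex, so
   existential quantification over X is harmless below. *)
Definition face_of (F S : set V) : Prop :=
  exists X Y : seq V,
    [/\ aff_indep X, S = conv X, {subset Y <= X} & F = conv Y].

Definition facet_of (F S : set V) : Prop :=
  exists X y, [/\ aff_indep X, S = conv X, y \in X & F = conv (rem y X)].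

(* S lists the top-dimensional simplices; P `<=` aff X says that the simplex
   conv X has the same dimension as P. *)
Definition triangulation (P : set V) (S : seq (set V)) : Prop :=
  let s i := nth set0 S i in
  [/\ forall i, (i < size S)%N ->
        exists X, [/\ aff_indep X, s i = conv X & P `<=` aff X],
      P = \bigcup_(i < size S) s i &
      forall i j, (i < size S)%N -> (j < size S)%N -> i != j ->
        [/\ s i <> s j, face_of (s i `&` s j) (s i) &
            face_of (s i `&` s j) (s j)]].

Definition shelling_order (P : set V) (S : seq (set V)) : Prop :=
  let s i := nth set0 S i in
  triangulation P S /\
  forall i, (0 < i < size S)%N ->
    let I := s i `&` \bigcup_(j < i) s j in
    I !=set0 /\
    exists2 Phi : set (set V),
      (forall F, Phi F -> facet_of F (s i)) & I = \bigcup_(F in Phi) F.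

End Polytopes.

Section Flows.
Local Open Scope ring_scope.
Local Open Scope classical_set_scope.
Variables (R : realFieldType) (n : nat) (K : multigraph n.+2).

Definition flow_space := {ffun edge K -> R^o}.

Definition netflow (f : flow_space) (v : 'I_n.+2) : R :=
  \sum_(e | src e == v) f e - \sum_(e | tgt e == v) f e.

Definition flow_polytope : set flow_space :=
  [set f : flow_space | (forall e, 0 <= f e) /\
     forall v, netflow f v = (v == ord0)%:R - (v == ord_max)%:R].

Definition unit_flow (A : {set edge K}) : flow_space := [ffun e => (e \in A)%:R].

End Flows.
Arguments flow_polytope R {n} K.

Section Tilde.
Variables (n : nat) (G : multigraph n).

Definition inner (i : 'I_n) : 'I_n.+2 := lift ord0 (widen_ord (leqnSn n) i).

(* The vertex s is ord0 and t is ord_max; inl (inl i) is the edge (s, i),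
   inl (inr i) the edge (i, t), and inr e the edge e of G. *)
Definition tilde_edge := ('I_n + 'I_n + edge G)%type.

Definition tilde_src (e : tilde_edge) : 'I_n.+2 :=
  match e with
  | inl (inl i) => ord0
  | inl (inr i) => inner i
  | inr e => inner (src e)
  end.

Definition tilde_tgt (e : tilde_edge) : 'I_n.+2 :=
  match e with
  | inl (inl i) => inner i
  | inl (inr i) => ord_max
  | inr e => inner (tgt e)
  end.

Lemma tilde_src_lt_tgt e : tilde_src e < tilde_tgt e.
Proof.
case: e => [[i|i]|e] //=; rewrite /bump /= !add1n.
  by rewrite ltnS ltn_ord.
by rewrite ltnS src_lt_tgt.
Qed.

Definition tilde : multigraph n.+2 := Multigraph tilde_src_lt_tgt.

Definition trivial_route (i : 'I_n) : {set edge tilde} :=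
  [set e : tilde_edge | (e == inl (inl i)) || (e == inl (inr i))].

Definition route (h : hedge G) : {set edge tilde} :=
  [set e : tilde_edge | match e with
                        | inl (inl i) => i == hsrc h
                        | inl (inr i) => i == htgt h
                        | inr e => e \in hsum h
                        end].

(* In a leaf H no two edges are consecutive, so these are all the routes from
   s to t in the graph obtained from H by adding s and t. *)
Definition leaf_vertices (R : realFieldType) (H : node G) :
    seq (flow_space R tilde) :=
  [seq unit_flow R (trivial_route i) | i <- enum 'I_n] ++
  [seq unit_flow R (route h) | h <- enum H].

Definition leaf_polytope (R : realFieldType) (H : node G) :
    set (flow_space R tilde) :=
  conv (leaf_vertices R H).

End Tilde.
Arguments leaf_polytope {n G} R H.

(* Main.v *)
Require Import Defs.
From HB Require Import structures.
From mathcomp Require Import all_boot all_order all_algebra.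
From mathcomp Require Import boolp classical_sets.
From mathcomp Require Import lra zify.

(* Let a weight on a node H be a function on its edges; a nonnegative weight
   on the root is the restriction to E(G) of a flow on the tilde graph.  A
   reduction on a, b moves min(w a, w b) from a and b to the new edge a + b.
   Edges of weight 0 can be ignored, because the order O chooses its pairs by
   comparisons that do not depend on the node.  So a weight on the root
   determines its weight on a leaf, whatever full dimensional leaf it ends in:
   two leaf simplices meet in the simplex of their common edges, and this gives
   the triangulation.

   For the shelling, let a path to a leaf F turn right at a node H that is
   reduced on a, b, and let F' be a leaf below the left child of H.  No edge of
   F that has the rest b of the right child as a summand belongs to F'.  If
   there is just one such edge r, the face of F opposite to r consists of
   weights with w a = w b on H, so it is also a face of a leaf below the left
   child.  Otherwise b is reduced further, and since a + b precedes b among the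
   edges into the same vertex, a later right turn on the path to F isolates a
   single edge r above b in the same way.  In both cases the facet of F
   opposite to r contains the intersection of F and F' and lies in an earlier
   leaf. *)

Set Implicit Arguments.
Unset Strict Implicit.
Unset Printing Implicit Defensive.
Import Order.TTheory GRing.Theory Num.Theory.


(** * Weights on nodes *)

Section Hedges.
Variables (n : nat) (G : multigraph n).
Implicit Types (a b h : hedge G) (H : node G).

Lemma hedge_eq a b :
  hsrc a = hsrc b -> htgt a = htgt b -> hsum a = hsum b -> a = b.
Proof.
by case: a b => [[? ?] ?] [[? ?] ?]; rewrite /hsrc /htgt /hsum /= => -> -> ->.
Qed.

(** As every edge of [G] goes upwards, these clauses say that [hsum h] is the edge set of a directed
    path from [hsrc h] to [htgt h]. The form by degree counts adds up over disjoint unions and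
    yields flow conservation. *)
Definition path_like h : Prop :=
  [/\ hsrc h < htgt h,
      forall e, e \in hsum h -> hsrc h <= src e /\ tgt e <= htgt h &
      forall v, \sum_(e in hsum h) (src e == v) + (htgt h == v) =
                \sum_(e in hsum h) (tgt e == v) + (hsrc h == v)].

(** Edges of [a] end at or before the common vertex, edges of [b] start at or after it. So the union
    in [new_edge] is a genuine formal sum. *)
Lemma path_like_disjoint a b : path_like a -> path_like b ->
  htgt a = hsrc b -> [disjoint hsum a & hsum b].
Proof.
move=> [_ pa _] [_ pb _] ab; rewrite -finset.setI_eq0 -finset.subset0.
apply/fintype.subsetP => e; rewrite inE => /andP[/pa[_ ea] /pb[eb _]].
by have := leq_trans (leq_ltn_trans eb (src_lt_tgt e)) ea; rewrite ab ltnn.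
Qed.

Lemma path_like_new_edge a b : path_like a -> path_like b ->
  htgt a = hsrc b -> path_like (new_edge a b).
Proof.
move=> pa pb ab; have dab := path_like_disjoint pa pb ab.
move: pa pb => [la pa sa] [lb pb sb]; split.
- by apply: ltn_trans la _; rewrite ab.
- move=> e; rewrite inE => /orP[/pa|/pb] [e1 e2] /=; split=> //.
    by apply: leq_trans e2 _; rewrite ab ltnW.
  by apply: leq_trans e1; rewrite -ab ltnW.
- have bigUc (F : edge G -> nat) : \sum_(e in hsum a :|: hsum b) F e =
      \sum_(e in hsum a) F e + \sum_(e in hsum b) F e.
    by rewrite -bigU //; apply: eq_bigl => e; rewrite !inE.
  move=> v; rewrite !bigUc.
  change (hsrc (new_edge a b)) with (hsrc a).
  change (htgt (new_edge a b)) with (htgt b).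
  have := sa v; have := sb v; rewrite ab; set s1 := bigop _ _ _.
  set s2 := bigop _ _ _; set s3 := bigop _ _ _; set s4 := bigop _ _ _.
  lia.
Qed.

Lemma reducible_distinct H a b : reducible H a b ->
  [/\ a != b, new_edge a b != a & new_edge a b != b].
Proof.
case/and5P=> _ _ la /eqP ab lb; split; apply: contraTneq isT => E.
- by move: la; rewrite ab E ltnn.
- have := congr1 (@htgt _ _) E; move: lb; rewrite -ab => /[swap] <-.
  by rewrite ltnn.
- have := congr1 (@hsrc _ _) E; move: la; rewrite ab => /[swap] <-.
  by rewrite ltnn.
Qed.

End Hedges.

Section Weights.
Variables (n : nat) (G : multigraph n) (R : realFieldType).
Local Notation W := (hedge G -> R).
Implicit Types (a b h : hedge G) (H F : node G) (u w : W).
Local Open Scope ring_scope.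

Definition supp_in w H : Prop := forall h, h \notin H -> w h = 0.
Definition nonneg w : Prop := forall h, 0 <= w h.
Definition support_set w : node G := [set h | w h != 0].
Definition eval w (e : edge G) : R := \sum_h w h *+ (e \in hsum h).
Definition delta (S : {set hedge G}) : W := fun h => (h \in S)%:R.

Definition shift (m : R) a b u : W := fun h =>
  u h + m *+ (h == new_edge a b) - m *+ (h == a) - m *+ (h == b).

Lemma shift_shift m m' a b u :
  shift m a b (shift m' a b u) = shift (m + m') a b u.
Proof. by apply: funext => h; rewrite /shift !mulrnDl; lra. Qed.

Lemma shift0 a b u : shift 0 a b u = u.
Proof. by apply: funext => h; rewrite /shift !mul0rn; lra. Qed.

Lemma shift_values H m a b u : reducible H a b ->
  [/\ shift m a b u a = u a - m, shift m a b u b = u b - m,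
      shift m a b u (new_edge a b) = u (new_edge a b) + m &
      forall h, h != a -> h != b -> h != new_edge a b -> shift m a b u h = u h].
Proof.
move=> /reducible_distinct[ab ca cb]; rewrite /shift; split.
- by rewrite (negPf ab) eq_sym (negPf ca) eqxx /=; lra.
- by rewrite eqxx ![b == _]eq_sym (negPf ab) (negPf cb) /=; lra.
- by rewrite eqxx (negPf ca) (negPf cb) /=; lra.
- by move=> h /negPf-> /negPf-> /negPf->; rewrite /=; lra.
Qed.

Lemma eval_shift m a b u : path_like a -> path_like b -> htgt a = hsrc b ->
  eval (shift m a b u) =1 eval u.
Proof.
move=> pa pb ab e; rewrite /eval.
under eq_bigr => h _ do rewrite /shift !mulrnBl mulrnDl.
have sum1 x : \sum_h m *+ (h == x) *+ (e \in hsum h) = m *+ (e \in hsum x).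
  rewrite (bigD1 x) //= eqxx big1 ?addr0 // => h /negPf->.
  by rewrite mul0rn.
rewrite !sumrB big_split /= !sum1 inE.
have := disjointFr (path_like_disjoint pa pb ab) (x := e).
by case: (e \in hsum a) => [->//|_]; rewrite /= ?mulr0n ?subr0 ?addrK //; lra.
Qed.

Definition independent H : Prop :=
  forall w, supp_in w H -> (forall e, eval w e = 0) -> forall h, w h = 0.

Definition nice H : Prop := (forall h, h \in H -> path_like h) /\ independent H.

Lemma independent_inj H u w : independent H -> supp_in u H -> supp_in w H ->
  eval u =1 eval w -> u = w.
Proof.
move=> iH su sw uw; apply: funext => h; apply/eqP; rewrite -subr_eq0; apply/eqP.
apply: (iH (fun h => u h - w h)) => [k kH|e]; first by rewrite su ?sw ?subrr.
rewrite /eval; under eq_bigr => k _ do rewrite mulrnBl.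
by rewrite sumrB -/(eval u e) -/(eval w e) uw subrr.
Qed.

(** Otherwise moving one unit from [a] and [b] to [a + b] would turn the zero weight into a
    nontrivial relation among the edges of [H]. Hence the outer reductions never merge two edges. *)
Lemma new_edge_notin H a b : nice H -> reducible H a b -> new_edge a b \notin H.
Proof.
move=> [pH iH] rab; apply/negP => cH.
have [aH bH _ /eqP ab _] := and5P rab.
have [va _ _ vo] := shift_values 1 (fun=> 0 : R) rab.
have : shift 1 a b (fun=> 0) a = 0.
  apply: iH => [h hH|e].
    by rewrite vo //; apply: contraNneq hH => ->.
  rewrite eval_shift //; [|exact: pH|exact: pH].
  by rewrite /eval big1 // => h _; rewrite mul0rn.
by rewrite va sub0r => /eqP; rewrite oppr_eq0 oner_eq0.
Qed.

End Weights.


(** * The two outer children of a node *)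

Section Children.
Variables (n : nat) (G : multigraph n) (R : realFieldType).
Implicit Types (a b h : hedge G) (H F K : node G) (u w : hedge G -> R).
Local Open Scope ring_scope.

Lemma supp_in_sub w H K : H \subset K -> supp_in w H -> supp_in w K.
Proof. by move=> /fintype.subsetP HK wH h hK; apply/wH/(contra (HK h)). Qed.

Lemma red1_sub H a b : red1 H a b \subset new_edge a b |: H.
Proof. by rewrite finset.setUS // finset.subD1set. Qed.

Lemma red2_sub H a b : red2 H a b \subset new_edge a b |: H.
Proof. by rewrite finset.setUS // finset.subD1set. Qed.

Lemma red1_notin H a b : reducible H a b -> b \notin red1 H a b.
Proof.
by move=> /reducible_distinct[_ _ cb]; rewrite !inE eqxx orbF eq_sym.
Qed.

Lemma red2_notin H a b : reducible H a b -> a \notin red2 H a b.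
Proof.
by move=> /reducible_distinct[_ ca _]; rewrite !inE eqxx orbF eq_sym.
Qed.

Lemma card_red1 H a b : new_edge a b \notin H -> reducible H a b ->
  #|red1 H a b| = #|H|.
Proof.
move=> cH /and5P[_ bH _ _ _].
by rewrite cardsU1 !inE (negPf cH) andbF (cardsD1 b H) bH.
Qed.

Lemma card_red2 H a b : new_edge a b \notin H -> reducible H a b ->
  #|red2 H a b| = #|H|.
Proof.
move=> cH /and5P[aH _ _ _ _].
by rewrite cardsU1 !inE (negPf cH) andbF (cardsD1 a H) aH.
Qed.

(** One formula inverts the move into either outer child: the new edge returns all its weight to [a]
    and [b]. *)
Definition unshift a b w := shift (- w (new_edge a b)) a b w.

Lemma unshift_supp H a b w : reducible H a b ->
  supp_in w (new_edge a b |: H) -> supp_in (unshift a b w) H.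
Proof.
move=> rab sw h hH; have [_ _ vc vo] := shift_values (- w (new_edge a b)) w rab.
have [->|hc] := eqVneq h (new_edge a b); first by rewrite /unshift vc subrr.
have [aH bH _ _ _] := and5P rab.
rewrite /unshift vo //; try by apply: contraNneq hH => ->.
by apply: sw; rewrite !inE negb_or hc.
Qed.

Lemma eval_unshift H a b w : nice R H -> reducible H a b ->
  eval (unshift a b w) =1 eval w.
Proof.
move=> [pH _] /and5P[aH bH _ /eqP ab _].
by apply: eval_shift => //; apply: pH.
Qed.

(** A relation on [K] is pulled back by [unshift] to one on [H], which is zero. Read at whichever of
    [a], [b] is missing from [K], this says that the new edge has weight zero; then all other
    weights vanish too. *)
Lemma child_nice H K a b : nice R H -> reducible H a b ->
  K \subset new_edge a b |: H -> (a \notin K) || (b \notin K) -> nice R K.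
Proof.
move=> nH rab sK abK; have [pH iH] := nH.
have [aH bH _ /eqP ab _] := and5P rab.
split=> [h /(fintype.subsetP sK)|w sw w0].
  rewrite !inE => /orP[/eqP->|]; last exact: pH.
  by apply: path_like_new_edge => //; exact: pH.
have z : forall h, unshift a b w h = 0.
  apply: iH => [|e]; first exact/(unshift_supp rab)/(supp_in_sub sK).
  by rewrite (eval_unshift _ nH rab).
have [va vb vc vo] := shift_values (- w (new_edge a b)) w rab.
have za := z a; have zb := z b; rewrite /unshift va in za.
rewrite /unshift vb in zb.
have wc : w (new_edge a b) = 0.
  by case/orP: abK => /sw E; rewrite E in za zb; lra.
move=> h; have [->//|hc] := eqVneq h (new_edge a b).
have [->|ha] := eqVneq h a; first by move: za; rewrite wc; lra.
have [->|hb] := eqVneq h b; first by move: zb; rewrite wc; lra.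
by have := z h; rewrite /unshift vo.
Qed.

Lemma nice_red1 H a b : nice R H -> reducible H a b -> nice R (red1 H a b).
Proof.
move=> nH rab; apply: (child_nice nH rab (red1_sub _ _ _)).
by rewrite (red1_notin rab) orbT.
Qed.

Lemma nice_red2 H a b : nice R H -> reducible H a b -> nice R (red2 H a b).
Proof.
move=> nH rab; apply: (child_nice nH rab (red2_sub _ _ _)).
by rewrite (red2_notin rab).
Qed.

Lemma shift_supp1 H a b u : reducible H a b -> supp_in u H ->
  supp_in (shift (u b) a b u) (red1 H a b).
Proof.
move=> rab su h; have [va vb vc vo] := shift_values (u b) u rab.
rewrite !inE negb_or negb_and negbK => /andP[hc /orP[/eqP->|hH]].
  by rewrite vb subrr.
have [aH bH _ _ _] := and5P rab.
by rewrite vo ?su //; apply: contraNneq hH => ->.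
Qed.

Lemma shift_supp2 H a b u : reducible H a b -> supp_in u H ->
  supp_in (shift (u a) a b u) (red2 H a b).
Proof.
move=> rab su h; have [va vb vc vo] := shift_values (u a) u rab.
rewrite !inE negb_or negb_and negbK => /andP[hc /orP[/eqP->|hH]].
  by rewrite va subrr.
have [aH bH _ _ _] := and5P rab.
by rewrite vo ?su //; apply: contraNneq hH => ->.
Qed.

Lemma shift_nonneg H m a b u : reducible H a b -> nonneg u ->
  0 <= m -> m <= u a -> m <= u b -> nonneg (shift m a b u).
Proof.
move=> rab u0 m0 ma mb h; have [va vb vc vo] := shift_values m u rab.
have [->|hc] := eqVneq h (new_edge a b); first by rewrite vc addr_ge0.
have [->|ha] := eqVneq h a; first by rewrite va subr_ge0.
have [->|hb] := eqVneq h b; first by rewrite vb subr_ge0.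
by rewrite vo.
Qed.

Lemma unshift_nonneg H a b w : reducible H a b ->
  nonneg w -> nonneg (unshift a b w).
Proof.
move=> rab w0 h; have [va vb vc vo] := shift_values (- w (new_edge a b)) w rab.
rewrite /unshift; have [->|hc] := eqVneq h (new_edge a b).
  by rewrite vc subrr.
have [->|ha] := eqVneq h a; first by rewrite va opprK addr_ge0.
have [->|hb] := eqVneq h b; first by rewrite vb opprK addr_ge0.
by rewrite vo.
Qed.

End Children.

(** * Reducing a single weight *)

Section Steps.
Variables (n : nat) (G : multigraph n) (R : realFieldType).
Variables lei leo : rel {set edge G}.
Hypotheses (lei_add : additive_order lei) (leo_add : additive_order leo).
Implicit Types (a b h : hedge G) (H F K : node G) (u w : hedge G -> R).
Local Open Scope ring_scope.
Local Notation rule := (ruleO lei leo).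

(** Pairs are chosen from the support and not from a node of a tree, so a run depends on its
    starting weight only. A run may stop early; the completed ones end in a [terminal] support. *)
Inductive steps : (hedge G -> R) -> (hedge G -> R) -> Prop :=
| steps_refl u : steps u u
| steps_step u a b w :
    reducible (support_set u) a b -> rule (support_set u) a b ->
    steps (shift (Num.min (u a) (u b)) a b u) w -> steps u w.

Definition terminal H : Prop := forall a b, ~~ reducible H a b.

Lemma terminal_sub H K : H \subset K -> terminal K -> terminal H.
Proof.
move=> /fintype.subsetP HK tK a b; apply: contra (tK a b).
by case/and5P=> /HK aK /HK bK ? ? ?; apply/and5P.
Qed.

Lemma support_set_sub w H : supp_in w H -> support_set w \subset H.
Proof.
move=> sw; apply/fintype.subsetP => h; rewrite inE; apply: contraNT => /sw->.
by rewrite eqxx.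
Qed.

(** The extremal pair of a support is unique, so two runs from [u] can differ only in length, and
    none continues past a terminal support. *)
Lemma steps_deterministic u w w' : steps u w -> steps u w' ->
  terminal (support_set w) -> terminal (support_set w') -> w = w'.
Proof.
move=> s; elim: s w' => {u w} [u|u a b w rab Rab _ IH] w' s'.
  case: s' => // u1 a b w1 rab _ _ tu _.
  by have := tu a b; rewrite rab.
case: s' rab Rab IH => [u1|u1 a' b' w1 rab' Rab' s'] rab Rab IH tw tw'.
  by have := tw' a b; rewrite rab.
have [? ?] := ruleO_unique lei_add leo_add rab Rab rab' Rab'; subst a' b'.
exact: IH.
Qed.

(* [rule] picks the extremal pair of a node, hence also of every subset that
   contains this pair: pairs with a zero weight can be ignored. *)
Lemma steps_shift H a b u w : reducible H a b -> rule H a b -> supp_in u H ->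
  nonneg u -> steps (shift (Num.min (u a) (u b)) a b u) w -> steps u w.
Proof.
move=> rab Rab su u0 s.
have [z|nz] := eqVneq (Num.min (u a) (u b)) 0; first by rewrite z shift0 in s.
have uab : (u a != 0) && (u b != 0).
  apply: contraNT nz; rewrite negb_and !negbK.
  case/orP => /eqP E; rewrite E; apply/eqP.
    by rewrite min_l.
  by rewrite min_r.
have sH := fintype.subsetP (support_set_sub su).
apply: steps_step s.
  have [_ _ la ab lb] := and5P rab; case/andP: uab => ua ub.
  by apply/and5P; split; rewrite ?inE.
move=> a' b' /and5P[/sH aH /sH bH la ab lb]; apply: Rab.
by apply/and5P.
Qed.

(** By [side_leaves_full] these are the full dimensional leaves in depth-first order; the recursive
    form suits inductions over the tree. *)
Fixpoint side_leaves (T : rtree G) : seq (node G) :=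
  match T with
  | Leaf H => [:: H]
  | Node _ l _ r => side_leaves l ++ side_leaves r
  end.

(** The weight is followed down the tree: left if [u b <= u a], right otherwise. The smaller of the
    two weights is used up, so the result is nonnegative and supported in that child. *)
Lemma side_leaves_cover H T u : reduction_tree rule H T -> nice R H ->
  supp_in u H -> nonneg u ->
  exists F w, [/\ F \in side_leaves T, supp_in w F, nonneg w,
    eval w =1 eval u & steps u w].
Proof.
move=> tT; elim: tT u =>
    {H T} [H tH|H a b T1 T3 T2 rab Rab _ IH1 _ _ _ IH2] u nH su u0.
  exists H, u; split=> //; [exact: mem_head|exact: steps_refl].
have [[pH _] [aH bH _ /eqP ab _]] := (nH, and5P rab).
have ev m : eval (shift m a b u) =1 eval u.
  by apply: eval_shift => //; exact: pH.
have [le|/ltW le] := leP (u b) (u a).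
- have [||F [w [Fl sw w0 ew s]]] := IH1 (shift (u b) a b u) (nice_red1 nH rab).
  + exact: shift_supp1.
  + exact: (shift_nonneg rab).
  exists F, w; split; rewrite //= ?mem_cat ?Fl //.
    by move=> e; rewrite ew ev.
  by apply: (steps_shift rab) => //; rewrite min_r.
- have [||F [w [Fl sw w0 ew s]]] := IH2 (shift (u a) a b u) (nice_red2 nH rab).
  + exact: shift_supp2.
  + exact: (shift_nonneg rab).
  exists F, w; split; rewrite //= ?mem_cat ?Fl ?orbT //.
    by move=> e; rewrite ew ev.
  by apply: (steps_shift rab) => //; rewrite min_l.
Qed.

End Steps.


(** * Paths to leaves *)

Section Orders.
Variables (n : nat) (G : multigraph n) (lei leo : rel {set edge G}).
Hypotheses (lei_add : additive_order lei) (leo_add : additive_order leo).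
Implicit Types (a b h x y : hedge G) (H K F : node G).
Local Notation rule := (ruleO lei leo).

(** If the reverse comparison held, adding [C] and antisymmetry would make the two unions equal, and
    removing the disjoint [C] would give [A = B]. *)
Lemma additive_order_cancel (A B C : {set edge G}) :
  [disjoint A & C] -> [disjoint B & C] ->
  lei (A :|: C) (B :|: C) -> lei A B.
Proof.
have [tot anti _ add] := lei_add => dA dB le.
have [//|le'] := orP (tot A B).
have E : A :|: C = B :|: C by apply: anti; rewrite le add.
have D (X : {set edge G}) : [disjoint X & C] -> X = (X :|: C) :\: C.
  move=> /disjoint_setI0 dX; rewrite finset.setDUl finset.setDv finset.setU0.
  by rewrite -[LHS](finset.setID X C) dX finset.set0U.
by have := tot B B; rewrite [X in lei X _](D _ dB) -E -(D _ dA) orbb.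
Qed.

Lemma in_le_refl x : in_le lei x x.
Proof.
rewrite /in_le eqxx ltnn /=; have [tot _ _ _] := lei_add.
by have := tot (hsum x) (hsum x); rewrite orbb.
Qed.

Lemma in_le_src x y : in_le lei x y -> hsrc x <= hsrc y.
Proof. by case/orP=> [/ltnW//|/andP[/eqP-> _]]. Qed.

Lemma not_in_le_src x y : ~~ in_le lei x y -> hsrc y <= hsrc x.
Proof. by rewrite negb_or -leqNgt => /andP[]. Qed.

Lemma in_le_ltF x y : hsrc y < hsrc x -> ~~ in_le lei x y.
Proof. by move=> lt; apply/negP => /in_le_src; rewrite leqNgt lt. Qed.

Lemma in_le_anti x y :
  htgt x = htgt y -> in_le lei x y -> in_le lei y x -> x = y.
Proof.
have [_ anti _ _] := lei_add => t /orP[lt /in_le_src|/andP[/eqP s l1]].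
  by rewrite leqNgt lt.
rewrite /in_le s ltnn eqxx /= => l2.
by apply: hedge_eq => //; apply: anti; rewrite l1.
Qed.

Lemma out_le_anti x y :
  hsrc x = hsrc y -> out_le leo x y -> out_le leo y x -> x = y.
Proof.
have [_ anti _ _] := leo_add => s /orP[lt|/andP[/eqP t l1]].
  move=> /orP[lt'|/andP[/eqP t _]]; last by rewrite t ltnn in lt.
  by have := ltn_trans lt lt'; rewrite ltnn.
rewrite /out_le t ltnn eqxx /= => l2.
by apply: hedge_eq => //; apply: anti; rewrite l1.
Qed.

Lemma in_le_new_edge x y b : path_like x -> path_like y -> path_like b ->
  htgt x = hsrc b -> htgt y = hsrc b ->
  in_le lei (new_edge x b) (new_edge y b) -> in_le lei x y.
Proof.
move=> px py pb xb yb /orP[lt|/andP[/eqP s le]]; rewrite /in_le.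
  by rewrite [hsrc x < hsrc y]lt.
change (hsrc x = hsrc y) in s; rewrite s eqxx /=; apply/orP; right.
by apply: additive_order_cancel le; apply: path_like_disjoint.
Qed.

Lemma child_elem H K a b h : K \subset new_edge a b |: H -> h \in K ->
  h = new_edge a b \/ h \in H.
Proof.
move=> /fintype.subsetP sK /sK; rewrite !inE => /orP[/eqP|]; by [left|right].
Qed.

(** The new edge ends beyond the vertex just reduced, and as the second edge of a pair it could be
    replaced by [a] in [H]. So the reduced vertices weakly increase along each path in the tree. *)
Lemma reducible_vertex_mono H K a b p q : reducible H a b -> rule H a b ->
  K \subset new_edge a b |: H -> reducible K p q -> htgt a <= htgt p.
Proof.
move=> rab Rab sK /and5P[pK qK lp /eqP pq lq].
have [aH bH la /eqP ab lb] := and5P rab.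
have [->|pH] := child_elem sK pK; first by rewrite ab ltnW.
have [Eq|qH] := child_elem sK qK; last first.
  by have [|//] := Rab p q; apply/and5P; split=> //; apply/eqP.
have [|//] := Rab p a; apply/and5P; split=> //.
by rewrite pq Eq.
Qed.

End Orders.

(** * Weights along a path to a leaf *)

Section Paths.
Variables (n : nat) (G : multigraph n) (R : realFieldType).
Variables lei leo : rel {set edge G}.
Hypotheses (lei_add : additive_order lei) (leo_add : additive_order leo).
Implicit Types (a b h r x y : hedge G) (H K F : node G) (u w : hedge G -> R).
Implicit Types (D : hedge G -> {set hedge G}).
Local Notation rule := (ruleO lei leo).
Local Open Scope ring_scope.

(** Passage from a child to its parent: whatever contains [a + b] contains [a] and [b]. The value at
    [a + b] is empty because this is not an edge of the parent. *)
Definition unfold_uses a b D : hedge G -> {set hedge G} := fun x =>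
  if x == new_edge a b then finset.set0
  else if (x == a) || (x == b) then D x :|: D (new_edge a b) else D x.

(* [leaf_path d H pre F D]: a path of length d without middle children leads
   from H to its leaf F; the leaves without middle children that precede F
   below H are listed in pre, and D x is the set of edges of F of which the
   edge x of H is a part. *)
Inductive leaf_path : nat -> node G -> seq (node G) -> node G ->
    (hedge G -> {set hedge G}) -> Prop :=
| leaf_path_end H : terminal H ->
    leaf_path 0 H [::] H (fun x => [set x] :&: H)
| leaf_path_left d H a b pre F D : reducible H a b -> rule H a b ->
    leaf_path d (red1 H a b) pre F D ->
    leaf_path d.+1 H pre F (unfold_uses a b D)
| leaf_path_right d H a b T1 pre F D : reducible H a b -> rule H a b ->
    reduction_tree rule (red1 H a b) T1 ->
    leaf_path d (red2 H a b) pre F D ->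
    leaf_path d.+1 H (side_leaves T1 ++ pre) F (unfold_uses a b D).

Lemma side_leaves_path H T i : reduction_tree rule H T ->
  (i < size (side_leaves T))%N ->
  exists d D, leaf_path d H (take i (side_leaves T))
                        (nth finset.set0 (side_leaves T) i) D.
Proof.
move=> tT; elim: tT i =>
    {H T} [H tH|H a b T1 T3 T2 rab Rab t1 IH1 _ _ t2 IH2] i.
  case: i => //= _; exists 0%N, (fun x => [set x] :&: H).
  exact: leaf_path_end.
rewrite /= size_cat nth_cat take_cat.
case: (ltnP i (size (side_leaves T1))) => [lt _|ge lt].
  have [d [D p]] := IH1 _ lt.
  by exists d.+1, (unfold_uses a b D); apply: (leaf_path_left rab).
have [|d [D p]] := IH2 (i - size (side_leaves T1))%N; first by lia.
by exists d.+1, (unfold_uses a b D); apply: (leaf_path_right rab).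
Qed.

Lemma mem_side_leaves_path H T F :
  reduction_tree rule H T -> F \in side_leaves T ->
  exists d pre D, leaf_path d H pre F D.
Proof.
move=> t Fl; have lt : (index F (side_leaves T) < size (side_leaves T))%N.
  by rewrite index_mem.
have [d [D]] := side_leaves_path t lt; rewrite nth_index // => p.
by exists d, (take (index F (side_leaves T)) (side_leaves T)), D.
Qed.

Lemma leaf_path_facts d H pre F D : leaf_path d H pre F D -> nice R H ->
  [/\ nice R F, terminal F & #|F| = #|H|].
Proof.
elim=> {d H pre F D} [H tH nH|d H a b pre F D rab _ _ IH nH|
    d H a b T1 pre F D rab _ _ _ IH nH] //.
- have [nF tF ->] := IH (nice_red1 nH rab); split=> //.
  by rewrite card_red1 // (new_edge_notin nH).
- have [nF tF ->] := IH (nice_red2 nH rab); split=> //.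
  by rewrite card_red2 // (new_edge_notin nH).
Qed.

Lemma leaf_path_uses d H pre F D : leaf_path d H pre F D -> nice R H ->
  forall x, D x \subset F /\ (x \notin H -> D x = finset.set0).
Proof.
elim=> {d H pre F D} [H tH nH|d H a b pre F D rab _ _ IH nH|
    d H a b T1 pre F D rab _ _ _ IH nH] x.
- split=> [|xH]; first exact: finset.subsetIr.
  by apply/disjoint_setI0; rewrite disjoints1.
- have {}IH := IH (nice_red1 nH rab); have [aH bH _ _ _] := and5P rab.
  rewrite /unfold_uses; split=> [|xH].
    have [_|_] := eqVneq x (new_edge a b); first exact: finset.sub0set.
    case: ifP => _; rewrite ?finset.subUset !(IH _).1 //.
  have [//|xc] := eqVneq x (new_edge a b).
  have [xa|_] /= := eqVneq x a; first by rewrite xa aH in xH.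
  have [xb|_] := eqVneq x b; first by rewrite xb bH in xH.
  by apply: (IH x).2; rewrite !inE negb_or xc negb_and xH orbT.
- have {}IH := IH (nice_red2 nH rab); have [aH bH _ _ _] := and5P rab.
  rewrite /unfold_uses; split=> [|xH].
    have [_|_] := eqVneq x (new_edge a b); first exact: finset.sub0set.
    case: ifP => _; rewrite ?finset.subUset !(IH _).1 //.
  have [//|xc] := eqVneq x (new_edge a b).
  have [xa|_] /= := eqVneq x a; first by rewrite xa aH in xH.
  have [xb|_] := eqVneq x b; first by rewrite xb bH in xH.
  by apply: (IH x).2; rewrite !inE negb_or xc negb_and xH orbT.
Qed.

(** With signs allowed, a weight can be sent into either outer child, hence into any leaf of this
    kind. This puts the flow polytope into the affine hull of each leaf simplex. *)
Lemma leaf_path_signed d H pre F D : leaf_path d H pre F D -> nice R H ->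
  forall u, supp_in u H -> exists2 w, supp_in w F & eval w =1 eval u.
Proof.
elim=> {d H pre F D} [H tH nH|d H a b pre F D rab _ _ IH nH|
    d H a b T1 pre F D rab _ _ _ IH nH] u su; first by exists u.
- have [w sw ew] := IH (nice_red1 nH rab) _ (shift_supp1 rab su).
  have [[pH _] [aH bH _ /eqP ab _]] := (nH, and5P rab).
  by exists w => // e; rewrite ew eval_shift //; exact: pH.
- have [w sw ew] := IH (nice_red2 nH rab) _ (shift_supp2 rab su).
  have [[pH _] [aH bH _ /eqP ab _]] := (nH, and5P rab).
  by exists w => // e; rewrite ew eval_shift //; exact: pH.
Qed.

Lemma unfold_uses_zero H a b u D w : reducible H a b -> nonneg u ->
  (forall x, u x = 0 <-> forall r, r \in D x -> w r = 0) ->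
  forall x, unshift a b u x = 0 <->
            forall r, r \in unfold_uses a b D x -> w r = 0.
Proof.
move=> rab u0 uD x; rewrite /unfold_uses.
have [va vb vc vo] := shift_values (- u (new_edge a b)) u rab.
have U y : u y + u (new_edge a b) = 0 <->
    forall r, r \in D y :|: D (new_edge a b) -> w r = 0.
  split=> [/eqP|z].
    rewrite paddr_eq0 // => /andP[/eqP/uD y0 /eqP/uD c0] r.
    by rewrite inE => /orP[/y0|/c0].
  have -> : u y = 0 by apply/uD => r ry; apply: z; rewrite inE ry.
  by rewrite add0r; apply/uD => r ry; apply: z; rewrite inE ry orbT.
have [->|xc] := eqVneq x (new_edge a b).
  by rewrite /unshift vc subrr; split=> // _ r; rewrite inE.
have [->|xa] /= := eqVneq x a; first by rewrite /unshift va opprK.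
have [->|xb] /= := eqVneq x b; first by rewrite /unshift vb opprK.
by rewrite /unshift vo.
Qed.

(** The reductions are undone from the leaf upwards. A sum of nonnegative weights vanishes only if
    each term does, so [D x] consists of exactly those edges of [F] whose weights must vanish for
    [x] to have weight zero. *)
Lemma leaf_path_lift d H pre F D : leaf_path d H pre F D -> nice R H ->
  forall w, supp_in w F -> nonneg w ->
  exists u, [/\ supp_in u H, nonneg u, eval u =1 eval w, steps lei leo u w &
    forall x, u x = 0 <-> forall r, r \in D x -> w r = 0].
Proof.
elim=> {d H pre F D} [H tH nH|d H a b pre F D rab Rab _ IH nH|
    d H a b T1 pre F D rab Rab _ _ IH nH] w sw w0.
- exists w; split=> //; first exact: steps_refl.
  move=> x; split=> [wx r|z]; first by rewrite !inE => /andP[/eqP->].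
  have [xH|/sw//] := boolP (x \in H).
  by apply: z; rewrite !inE eqxx.
- have [u [su u0 eu st uD]] := IH (nice_red1 nH rab) w sw w0.
  have su' := unshift_supp rab (supp_in_sub (red1_sub _ _ _) su).
  exists (unshift a b u); split=> //.
  + exact: unshift_nonneg rab u0.
  + by move=> e; rewrite (eval_unshift _ nH rab).
  + apply: (steps_shift rab) => //; first exact: unshift_nonneg rab u0.
    (* The left child lacks [b], so the lifted weight has at [b] just the weight of the new edge.
       This is the minimum, and the step gives back [u]. *)
    have [va vb vc vo] := shift_values (- u (new_edge a b)) u rab.
    rewrite /unshift va vb (su b) ?red1_notin // sub0r !opprK min_r ?lerDr //.
    by rewrite shift_shift subrr shift0.
  + exact: (unfold_uses_zero rab).
- have [u [su u0 eu st uD]] := IH (nice_red2 nH rab) w sw w0.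
  have su' := unshift_supp rab (supp_in_sub (red2_sub _ _ _) su).
  exists (unshift a b u); split=> //.
  + exact: unshift_nonneg rab u0.
  + by move=> e; rewrite (eval_unshift _ nH rab).
  + apply: (steps_shift rab) => //; first exact: unshift_nonneg rab u0.
    have [va vb vc vo] := shift_values (- u (new_edge a b)) u rab.
    rewrite /unshift va vb (su a) ?red2_notin // sub0r !opprK min_l ?lerDr //.
    by rewrite shift_shift subrr shift0.
  + exact: (unfold_uses_zero rab).
Qed.

Lemma delta_supp (S : node G) F : S \subset F -> supp_in (delta R S) F.
Proof.
by move=> /fintype.subsetP sS h hF; rewrite /delta (negPf (contra (sS h) hF)).
Qed.

Lemma delta_nonneg (S : node G) : nonneg (delta R S).
Proof. by move=> h; rewrite /delta ler0n. Qed.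

Lemma support_delta (S : node G) : support_set (delta R S) = S.
Proof.
apply/setP => h; rewrite inE /delta.
by case: (h \in S); rewrite ?oner_eq0 ?eqxx.
Qed.

(* The barycenter of the edges of F other than r has equal weights on a and b,
   hence lies in the left child as well. *)
Lemma leaf_path_flip d H a b T1 pre F D r : nice R H ->
  reducible H a b -> rule H a b -> reduction_tree rule (red1 H a b) T1 ->
  leaf_path d (red2 H a b) pre F D -> D b = [set r] ->
  exists2 F', F' \in side_leaves T1 & F :\ r \subset F'.
Proof.
move=> nH rab Rab t1 p Db.
have sF : F :\ r \subset F := finset.subD1set _ _.
have n2 := nice_red2 nH rab.
have [u [su u0 eu st uD]] :=
  leaf_path_lift p n2 (delta_supp sF) (@delta_nonneg _).
(* Above [b] there is only [r], which has weight zero here. As the right child lacks [a], the weight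
   [u] vanishes on [a] and [b] and is also supported in the left child. *)
have ub : u b = 0.
  apply/uD => r'; rewrite Db inE => /eqP->.
  by rewrite /delta !inE eqxx.
have su1 : supp_in u (red1 H a b).
  move=> h; have [->//|hb] := eqVneq h b; have [->|ha] := eqVneq h a.
    by move=> _; apply: su; apply: red2_notin.
  by rewrite !inE hb /= => h1; apply: su; rewrite !inE ha.
have [F' [w [F'l sw w0 _ st']]] :=
  side_leaves_cover t1 (nice_red1 nH rab) su1 u0.
exists F' => //.
have [_ tF _] := leaf_path_facts p n2.
have [d' [pre' [D' p']]] := mem_side_leaves_path t1 F'l.
have [_ tF' _] := leaf_path_facts p' (nice_red1 nH rab).
(* Both runs start from [u], so they end in the same weight, whose support is [F :\ r]. *)
have E := steps_deterministic lei_add leo_add st st'.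
rewrite -[F :\ r]support_delta E; first exact: support_set_sub.
- by rewrite support_delta; apply: terminal_sub tF.
- exact: terminal_sub (support_set_sub sw) tF'.
Qed.

End Paths.


(** * The exchange property *)

Section Exchange.
Variables (n : nat) (G : multigraph n) (R : realFieldType).
Variables lei leo : rel {set edge G}.
Hypotheses (lei_add : additive_order lei) (leo_add : additive_order leo).
Implicit Types (a b h r x y : hedge G) (H K F : node G) (u w : hedge G -> R).
Implicit Types (D : hedge G -> {set hedge G}).
Local Notation rule := (ruleO lei leo).
Local Notation "x <_in y" := (~~ in_le lei y x) (at level 70).

(* The condition on [y] survives reductions because, with [y] in place, [x] is
   never the first edge into its target to be reduced. *)
Definition dominated K x y : Prop :=
  [/\ x \in K, y \in K, htgt y = htgt x & y <_in x] /\
  (forall p q, reducible K p q -> hsrc x <= htgt p) /\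
  (forall a, a \in K -> htgt a = hsrc x -> y <_in new_edge a x).

Definition exchangeable (pre : seq (node G)) F (X : {set hedge G}) : Prop :=
  exists r F', [/\ r \in X, F' \in pre & F :\ r \subset F'].

Lemma exchangeable_sub pre pre' F (X X' : {set hedge G}) :
  {subset pre <= pre'} -> X \subset X' ->
  exchangeable pre F X -> exchangeable pre' F X'.
Proof.
move=> sp /fintype.subsetP sX [r [F' [/sX rX /sp F'p sF]]].
by exists r, F'.
Qed.

Lemma unfold_uses_same a b D x : x != a -> x != b -> x != new_edge a b ->
  unfold_uses a b D x = D x.
Proof. by rewrite /unfold_uses => /negPf-> /negPf-> /negPf->. Qed.

Lemma unfold_uses_old H a b D x : new_edge a b \notin H -> x \in H ->
  (x == a) || (x == b) -> unfold_uses a b D x = D x :|: D (new_edge a b).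
Proof.
rewrite /unfold_uses => cH xH ->; case: eqVneq => // E.
by rewrite E (negPf cH) in xH.
Qed.

(** The reduction takes place at or after the source of [x], and the new edge ends strictly beyond
    that vertex. So it does not end at the source of [x], and the condition on [y] gains no
    instance. *)
Lemma dominated_child H K a b x y : reducible H a b -> rule H a b ->
  K \subset new_edge a b |: H -> x \in K -> y \in K ->
  dominated H x y -> dominated K x y.
Proof.
move=> rab Rab sK xK yK [[xH yH t lt] [vx yx]].
have lev : hsrc x <= htgt a := vx _ _ rab.
split; first by split.
split=> [p q rpq|a' a'K ta'].
  exact: leq_trans lev (reducible_vertex_mono rab Rab sK rpq).
have [E|a'H] := child_elem sK a'K; last exact: yx.
have [_ _ _ /eqP ab lb] := and5P rab.
move: lev; rewrite -ta' E ab leqNgt /htgt /=; rewrite -/(htgt b).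
by rewrite lb.
Qed.

(** An edge ending at the source of [x] would form a reducible pair with [x] there, so the last
    clause of [dominated] is void. *)
Lemma dominated_low K x y : nice R K -> x \in K -> y \in K -> htgt y = htgt x ->
  y <_in x -> (forall p q, reducible K p q -> hsrc x < htgt p) ->
  dominated K x y.
Proof.
move=> [pK _] xK yK t lt low; split; first by split.
split=> [p q /low/ltnW//|a aK ta].
have [la _ _] := pK _ aK; have [lx _ _] := pK _ xK.
have : reducible K a x by apply/and5P; split=> //; apply/eqP.
by move/low; rewrite ta ltnn.
Qed.

(** An edge [a'] still ending at this vertex comes after [a], which was minimal and is now removed.
    By cancellation of [b], the edge [a' + b] comes after [a + b]. *)
Lemma dominated_new_edge H a b : nice R H -> reducible H a b -> rule H a b ->
  dominated (red2 H a b) b (new_edge a b).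
Proof.
move=> [pH _] rab Rab; have [aH bH la /eqP ab lb] := and5P rab.
have [na _ _] := reducible_distinct rab.
have bin : b \in red2 H a b by rewrite !inE bH [b == a]eq_sym na orbT.
have cin : new_edge a b \in red2 H a b by rewrite !inE eqxx.
split; first by split=> //; apply: in_le_ltF; rewrite -ab.
split=> [p q rpq|a' a'K ta'].
  by rewrite -ab; exact: reducible_vertex_mono rab Rab (red2_sub _ _ _) rpq.
have [E|a'H] := child_elem (red2_sub _ _ _) a'K.
  by move: lb; rewrite -ta' E ltnn.
have ra' : reducible H a' b.
  by apply/and5P; split=> //; [have [] := pH _ a'H|apply/eqP].
have ta : htgt a' = htgt a by rewrite ta' ab.
have [_ /(_ ta)[le _]] := Rab _ _ ra'.
apply/negP => /in_le_new_edge le'.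
have {}le' : in_le lei a' a by apply: le' => //; apply: pH.
move: a'K; rewrite (in_le_anti lei_add ta le' le).
by apply/negP; exact: red2_notin.
Qed.

(** Induction on the length of the path, replacing [x] and [y] by their successors. As [y] precedes
    [x] at their common target, [x] is never the chosen [a]. The delicate case is a right turn that
    deletes [y]: it may take two turns at once, hence the strong induction. *)
Lemma exchange_dominated d K pre F D x y : nice R K ->
  leaf_path lei leo d K pre F D -> dominated K x y ->
  (exists r, D x = [set r]) \/ exchangeable pre F (D x).
Proof.
have [m] := ubnP d; elim: m => // m IH in d K pre F D x y * => /ltnSE dm nK p.
case: p dm nK => {d K pre F D} [K tK|d K a b pre F D rab Rab p|
    d K a b T1 pre F D rab Rab t1 p] dm nK dom.
- left; exists x; have [[xK _ _ _] _] := dom.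
  by apply/finset.setIidPl; rewrite finset.sub1set.
- have n1 := nice_red1 nK rab.
  have cK := new_edge_notin nK rab.
  have [aK bK la /eqP ab lb] := and5P rab.
  have [na ca cb] := reducible_distinct rab.
  have [[xK yK t lt] [vx yx]] := dom.
  have cin : new_edge a b \in red1 K a b by rewrite !inE eqxx.
  have low := reducible_vertex_mono rab Rab (red1_sub K a b).
  have xc : x != new_edge a b by apply: contraNneq cK => <-.
  have yc : y != new_edge a b by apply: contraNneq cK => <-.
  (* If [x] were [a], then [y] and [b] would form a reducible pair, and the rule would place [x]
     before [y]. *)
  have xa : x != a.
    apply: contraNneq lt => xa.
    have [|_ le] := Rab y b; last by rewrite xa; case: le; rewrite // -xa t.
    apply/and5P; split=> //; first by have [pK _] := nK; have [] := pK _ yK.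
    by rewrite t xa; apply/eqP.
  (* A left turn deletes [b]. If [x = b], all uses of [x] pass to [a + x], which [y] dominates by
     the last clause of [dominated]. *)
  have [xb|xb] := eqVneq x b.
  + have [||] := IH d _ _ _ _ (new_edge a b) y dm n1 p.
      subst x; apply: dominated_low => //.
      * rewrite !inE yK andbT; apply/orP; right.
        by apply: contraTneq lt => ->; rewrite negbK; exact: in_le_refl.
      * exact: yx.
      * by move=> p' q' /low; apply: leq_trans.
    * subst x; move=> [r Dr]; left; exists r.
      rewrite (unfold_uses_old _ cK) ?eqxx ?orbT // Dr.
      by rewrite ((leaf_path_uses p n1 b).2 (red1_notin rab)) finset.set0U.
    * move=> ex; right; apply: exchangeable_sub ex => //.
      by rewrite (unfold_uses_old _ cK) ?xb ?eqxx ?orbT // finset.subsetUr.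
  + rewrite unfold_uses_same //.
    have xin : x \in red1 K a b by rewrite !inE xb xK orbT.
    have [yb|yb] := eqVneq y b; last first.
      apply: (IH d _ _ _ _ x y dm n1 p).
      apply: (dominated_child rab Rab (red1_sub _ _ _)) => //.
      by rewrite !inE yb yK orbT.
    (* The deleted [y = b] is succeeded by [a + b], which has the same target and starts earlier. *)
    have lty : hsrc (new_edge a b) < hsrc y by rewrite yb -ab.
    apply: (IH d _ _ _ _ x (new_edge a b) dm n1 p); split; first split=> //.
    * by rewrite -t yb.
    * by apply: in_le_ltF; apply: leq_trans lty (not_in_le_src lt).
    split=> [p' q' /low|a' a'K ta'].
      by apply: leq_trans; apply: vx rab.
    have [E|a'H] := child_elem (red1_sub _ _ _) a'K.
      have := vx _ _ rab; rewrite -ta' E ab leqNgt.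
      by rewrite (_ : htgt (new_edge a b) = htgt b) ?lb.
    by apply: in_le_ltF; apply: leq_trans lty (not_in_le_src (yx _ a'H ta')).
- have n2 := nice_red2 nK rab.
  have cK := new_edge_notin nK rab.
  have [aK bK la /eqP ab lb] := and5P rab.
  have [na ca cb] := reducible_distinct rab.
  have [[xK yK t lt] [vx yx]] := dom.
  have cin : new_edge a b \in red2 K a b by rewrite !inE eqxx.
  have bin : b \in red2 K a b by rewrite !inE bK [b == a]eq_sym na orbT.
  have low := reducible_vertex_mono rab Rab (red2_sub K a b).
  have flip := leaf_path_flip lei_add leo_add nK rab Rab t1 p.
  have prer : {subset pre <= side_leaves T1 ++ pre}.
    by move=> F' F'p; rewrite mem_cat F'p orbT.
  have prel : {subset side_leaves T1 <= side_leaves T1 ++ pre}.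
    by move=> F' F'p; rewrite mem_cat F'p.
  have xc : x != new_edge a b by apply: contraNneq cK => <-.
  have yc : y != new_edge a b by apply: contraNneq cK => <-.
  have [pK _] := nK.
  have xa : x != a.
    apply: contraNneq lt => xa.
    have [|_ le] := Rab y b; last by rewrite xa; case: le; rewrite // -xa t.
    apply/and5P; split=> //; first by have [] := pK _ yK.
    by rewrite t xa; apply/eqP.
  (* The right child keeps [b], now dominated by [a + b]. If a single edge of [F] lies above [b],
     the left subtree supplies the exchange. *)
  have [xb|xb] := eqVneq x b.
    have sDb : D b \subset unfold_uses a b D x.
      by rewrite (unfold_uses_old _ cK) ?xb ?eqxx ?orbT // finset.subsetUl.
    right; have [|[r Dr]|ex] := IH d _ _ _ _ b (new_edge a b) dm n2 p.
    * exact: dominated_new_edge.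
    * have [F' F'l sF] := flip _ Dr.
      exists r, F'; split=> //; last exact: prel.
      by apply: (fintype.subsetP sDb); rewrite Dr inE.
    * exact: exchangeable_sub ex.
  rewrite unfold_uses_same //.
  have xin : x \in red2 K a b by rewrite !inE xa xK orbT.
  have [ya|ya] := eqVneq y a; last first.
    have [||ex] := IH d _ _ _ _ x y dm n2 p; [|by left|].
      apply: (dominated_child rab Rab (red2_sub _ _ _)) => //.
      by rewrite !inE ya yK orbT.
    by right; apply: exchangeable_sub ex.
  (* Now [y = a] is deleted. Since [x] and [b] are consecutive, the next reduction is at the same
     vertex. It chooses either an edge before [x], which takes over the role of [y], or [x]
     itself. *)
  have ltx : hsrc x < htgt a by rewrite -ya t; have [] := pK _ xK.
  have txb : htgt x = hsrc b by rewrite -t ya.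
  have lx : hsrc x < htgt x by have [] := pK _ xK.
  have rxb : reducible (red2 K a b) x b.
    by apply/and5P; split=> //; apply/eqP.
  have lowx p' q' : reducible (red2 K a b) p' q' -> hsrc x < htgt p'.
    by move/low; apply: leq_trans.
  have [a' [b' [rab' Rab']]] := ruleO_exists lei_add leo_add rxb.
  have [le_a' le] := Rab' _ _ rxb.
  have ta' : htgt x = htgt a'.
    by apply/ord_inj/eqP; rewrite -t ya eqn_leq (low _ _ rab') -ya t.
  have [le_in_x le_out_b] := le ta'.
  have [a'K b'K la' /eqP ab' lb'] := and5P rab'.
  have [xa'|xa'] := eqVneq a' x; last first.
    have [||ex] := IH d _ _ _ _ x a' dm n2 p; [|by left|].
      apply: dominated_low => //; apply/negP => le'.
      by rewrite (in_le_anti lei_add ta' le' le_in_x) eqxx in xa'.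
    by right; apply: exchangeable_sub ex.
  subst a'.
  (* The out-edges [b] and [b'] of this vertex are available both to [a] in the parent and to [x] in
     the child, so each precedes the other. *)
  have bb' : b' = b.
    have sb' : hsrc b' = htgt a by rewrite -ab' -t ya.
    have b'H : b' \in K.
      have [E|//] := child_elem (red2_sub _ _ _) b'K.
      by move: la; rewrite -sb' E ltnn.
    have rabb' : reducible K a b' by apply/and5P; split=> //; apply/eqP.
    have [_ /(_ erefl)[_ le_out_b']] := Rab _ _ rabb'.
    by apply: out_le_anti le_out_b le_out_b' => //; rewrite -ab' -txb.
  subst b'.
  have lt_new : new_edge a b <_in new_edge x b.
    apply/negP => /in_le_new_edge le'; move: lt; rewrite ya => /negP[].
    by apply: le' => //; apply: pK.
  have low2 K2 : K2 \subset new_edge x b |: red2 K a b ->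
      forall p' q', reducible K2 p' q' -> hsrc (new_edge x b) < htgt p'.
    move=> s2 p' q' r2; apply: leq_trans lx _.
    exact: reducible_vertex_mono rxb Rab' s2 r2.
  have cx : new_edge a b != x by rewrite eq_sym.
  have c2 := new_edge_notin n2 rxb.
  move: dm n2 cin xin bin rxb Rab' flip prer prel c2 low2.
  move: (red2 K a b) p => K' p.
  case: p => {d K' pre F D} [K' tK'|d K' a2 b2 pre F D rab2 Rab2 p|
      d K' a2 b2 T2 pre F D rab2 Rab2 t2 p]
      dm n2 cin xin bin rxb Rab' flip prer prel c2 low2.
  + by have := tK' x b; rewrite rxb.
  + have [? ?] := ruleO_unique lei_add leo_add rab2 Rab2 rxb Rab'; subst a2 b2.
    have n3 := nice_red1 n2 rxb.
    have Dx := unfold_uses_old D c2 xin; rewrite eqxx in Dx.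
    have Db := unfold_uses_old D c2 bin; rewrite eqxx orbT in Db.
    rewrite ((leaf_path_uses p n3 b).2 (red1_notin rxb)) finset.set0U in Db.
    (* After this left turn, [b] is used only through [x + b]. If [r] is the only such use, the
       exchange is made at the previous right turn, on [a] and [b]. *)
    have [||[r Dr]|ex] := IH d _ _ _ _ (new_edge x b) (new_edge a b) _ n3 p.
    * exact: ltnW.
    * apply: dominated_low => //; rewrite ?inE ?eqxx //.
        by rewrite cb cin orbT.
      exact/low2/red1_sub.
    * right; have [|F' F'l sF] := flip r; first by rewrite Db.
      exists r, F'; split=> //; last exact: prel.
      by rewrite Dx // Dr !inE eqxx orbT.
    * right; apply: exchangeable_sub ex => //.
      by rewrite Dx // finset.subsetUr.
  + have [? ?] := ruleO_unique lei_add leo_add rab2 Rab2 rxb Rab'; subst a2 b2.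
    have n3 := nice_red2 n2 rxb.
    have Dx := unfold_uses_old D c2 xin; rewrite eqxx in Dx.
    rewrite Dx // ((leaf_path_uses p n3 x).2 (red2_notin rxb)) finset.set0U.
    have [||[r Dr]|ex] := IH d _ _ _ _ (new_edge x b) (new_edge a b) _ n3 p.
    * exact: ltnW.
    * apply: dominated_low => //; rewrite ?inE ?eqxx //.
        by rewrite cx cin orbT.
      exact/low2/red2_sub.
    * by left; exists r.
    * right; apply: exchangeable_sub ex => // F' F'p.
      by apply: prer; rewrite mem_cat F'p orbT.
Qed.

(** The edge [r] is found at the node where the paths to [Fj] and [F] part: it is one of the edges
    of [F] above the [b] of that node, and none of these occurs in a leaf from the left subtree. *)
Lemma shelling_exchange d H pre F D :
  nice R H -> leaf_path lei leo d H pre F D ->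
  forall Fj, Fj \in pre -> exists r F',
    [/\ r \in F, r \notin Fj, F' \in pre & F :\ r \subset F'].
Proof.
move=> nH p; elim: p nH => {d H pre F D} [//|d H a b pre F D rab _ p IH nH|
    d H a b T1 pre F D rab Rab t1 p IH nH] Fj.
  exact: IH (nice_red1 nH rab) Fj.
have n1 := nice_red1 nH rab; have n2 := nice_red2 nH rab.
rewrite mem_cat => /orP[Fjl|]; last first.
  move=> /(IH n2)[r [F' [rF rFj F'p sF]]].
  by exists r, F'; rewrite mem_cat F'p orbT.
have [pH iH] := nH.
have ex : exists r F',
    [/\ r \in D b, F' \in side_leaves T1 ++ pre & F :\ r \subset F'].
  have [|[r Dr]|[r [F' [rD F'p sF]]]] :=
      exchange_dominated (x := b) (y := new_edge a b) n2 p.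
  - exact: dominated_new_edge.
  - have [F' F'l sF] := leaf_path_flip lei_add leo_add nH rab Rab t1 p Dr.
    by exists r, F'; rewrite Dr inE eqxx mem_cat F'l.
  - by exists r, F'; rewrite mem_cat F'p orbT.
have [r [F' [rD F'p sF]]] := ex.
have rF : r \in F by apply: (fintype.subsetP (leaf_path_uses p n2 b).1).
(* If [r] were in [Fj], its unit weight would lift through both children to the same weight on [H].
   The values at [a] and [b] then give [u1 a + u2 b = 0], so [u2 b = 0], although [r] lies above
   [b]. *)
exists r, F'; split=> //; apply/negP => rFj.
have sub (X : node G) : r \in X -> supp_in (delta R [set r]) X.
  by move=> rX; apply: delta_supp; rewrite finset.sub1set.
have [u2 [su2 u2_ge0 eu2 _ uD2]] :=
  leaf_path_lift p n2 (sub _ rF) (@delta_nonneg _ _ R _).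
have [d' [pre' [D' p']]] := mem_side_leaves_path t1 Fjl.
have [u1 [su1 u1_ge0 eu1 _ _]] :=
  leaf_path_lift p' n1 (sub _ rFj) (@delta_nonneg _ _ R _).
have E : unshift a b u1 = unshift a b u2.
  apply: (independent_inj iH).
  - by apply: (unshift_supp rab); apply: supp_in_sub su1; exact: red1_sub.
  - by apply: (unshift_supp rab); apply: supp_in_sub su2; exact: red2_sub.
  - by move=> e; rewrite !(eval_unshift _ nH rab) eu1 eu2.
have := congr1 (fun f => f a) E; have := congr1 (fun f => f b) E.
rewrite /unshift /= => Eb Ea.
have [va1 vb1 _ _] := shift_values (- u1 (new_edge a b))%R u1 rab.
have [va2 vb2 _ _] := shift_values (- u2 (new_edge a b))%R u2 rab.
rewrite va1 va2 (su2 a (red2_notin rab)) in Ea.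
rewrite vb1 vb2 (su1 b (red1_notin rab)) in Eb.
have u2b : u2 b = 0%R.
  by have := u1_ge0 a; have := u2_ge0 b; lra.
by have /eqP := (uD2 b).1 u2b r rD; rewrite /delta inE eqxx oner_eq0.
Qed.

End Exchange.


(** * Full dimensional leaves *)

Section Root.
Variables (n : nat) (G : multigraph n) (R : realFieldType).
Local Open Scope ring_scope.

Definition root_edge (e : edge G) : hedge G := (src e, tgt e, [set e]).

Lemma root_edge_inj : injective root_edge.
Proof. by move=> e e' [_ _ /finset.set1_inj]. Qed.

Lemma card_root_node : #|root_node G| = #|edge G|.
Proof. exact: card_imset root_edge_inj. Qed.

Lemma root_path_like e : path_like (root_edge e).
Proof.
split=> [|e'|v] /=; first exact: src_lt_tgt.
  by rewrite inE => /eqP->.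
by rewrite !big_set1 addnC.
Qed.

Definition root_weight (f : edge G -> R) : hedge G -> R :=
  fun h => \sum_e f e *+ (h == root_edge e).

Lemma root_weightE f e : root_weight f (root_edge e) = f e.
Proof.
rewrite /root_weight (bigD1 e) //= eqxx big1 ?addr0 // => e' /negPf ne.
by rewrite (inj_eq root_edge_inj) eq_sym ne.
Qed.

Lemma root_weight_supp f : supp_in (root_weight f) (root_node G).
Proof.
move=> h hR; rewrite /root_weight big1 // => e _.
by have [he|//] := eqVneq h (root_edge e); rewrite he imset_f in hR.
Qed.

Lemma eval_root (w : hedge G -> R) e :
  supp_in w (root_node G) -> eval w e = w (root_edge e).
Proof.
move=> sw; rewrite /eval (bigD1 (root_edge e)) //= inE eqxx big1 ?addr0 // => h.
have [/imsetP[e' _ ->]|/sw-> _] := boolP (h \in root_node G); last first.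
  by rewrite mul0rn.
by rewrite -/(root_edge _) (inj_eq root_edge_inj) !inE eq_sym => /negPf->.
Qed.

Lemma nice_root : nice R (root_node G).
Proof.
split=> [h /imsetP[e _ ->]|w sw w0 h]; first exact: root_path_like.
have [/imsetP[e _ ->]|/sw//] := boolP (h \in root_node G).
by rewrite -[RHS](w0 e) (eval_root _ sw).
Qed.

End Root.

Section FullLeaves.
Variables (n : nat) (G : multigraph n) (R : realFieldType).
Variables lei leo : rel {set edge G}.
Hypotheses (lei_add : additive_order lei) (leo_add : additive_order leo).
Implicit Types (H F : node G) (u w : hedge G -> R).
Local Notation rule := (ruleO lei leo).

Lemma card_leaves H T F :
  reduction_tree rule H T -> F \in leaves T -> #|F| <= #|H|.
Proof.
elim=> {H T} [H _|H a b T1 T3 T2 rab _ _ IH1 _ IH3 _ IH2].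
  by rewrite inE => /eqP->.
have [aH bH _ _ _] := and5P rab; have [na _ _] := reducible_distinct rab.
have U (K : node G) c : #|c |: K| <= #|K|.+1.
  by rewrite cardsU1; case: (c \notin K).
rewrite !mem_cat => /or3P[/IH1|/IH3|/IH2] le; apply: leq_trans le _.
- by apply: leq_trans (U _ _) _; rewrite (cardsD1 b H) bH.
- apply: leq_trans (U _ _) _.
  rewrite (cardsD1 a H) aH ltnS; apply/subset_leq_card/finset.subD1set.
- by apply: leq_trans (U _ _) _; rewrite (cardsD1 a H) aH.
Qed.

Lemma card_leaves_red3 H a b T F : reducible H a b ->
  reduction_tree rule (red3 H a b) T -> F \in leaves T -> #|F| < #|H|.
Proof.
move=> rab t Fl; apply: leq_ltn_trans (card_leaves t Fl) _.
have [aH bH _ _ _] := and5P rab; have [na _ _] := reducible_distinct rab.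
rewrite (cardsD1 a H) aH (cardsD1 b (H :\ a)) !inE bH eq_sym na /= !add1n ltnS.
by rewrite cardsU1; case: (_ \notin _).
Qed.

(** Outer children have as many edges as their parent, by [new_edge_notin]. Below a middle child at
    least one edge is lost for good. *)
Lemma side_leaves_full H T : reduction_tree rule H T -> nice R H ->
  [seq F : node G <- leaves T | #|F| == #|H|] = side_leaves T.
Proof.
elim=> {H T} [H _ _|H a b T1 T3 T2 rab Rab t1 IH1 t3 _ t2 IH2 nH] /=.
  by rewrite eqxx.
have cH := new_edge_notin nH rab.
rewrite !filter_cat.
rewrite -(card_red1 cH rab) (IH1 (nice_red1 nH rab)) card_red1 //.
rewrite -(card_red2 cH rab) (IH2 (nice_red2 nH rab)) card_red2 //.
rewrite (_ : filter _ (leaves T3) = [::]) //.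
rewrite -(filter_pred0 (leaves T3)); apply: eq_in_filter => F Fl /=.
by rewrite ltn_eqF // (card_leaves_red3 rab t3).
Qed.

(** Both weights lift to [H], where independence makes the lifts equal; each weight is the end of
    the completed run from this common lift. *)
Lemma side_leaves_unique H T F F' w w' : reduction_tree rule H T -> nice R H ->
  F \in side_leaves T -> F' \in side_leaves T ->
  supp_in w F -> supp_in w' F' -> nonneg w -> nonneg w' ->
  eval w =1 eval w' -> w = w'.
Proof.
move=> t nH /(mem_side_leaves_path t)[d [pre [D p]]].
move=> /(mem_side_leaves_path t)[d' [pre' [D' p']]] sw sw' w0 w0' E.
have [u [su _ eu st _]] := leaf_path_lift p nH sw w0.
have [u' [su' _ eu' st' _]] := leaf_path_lift p' nH sw' w0'.
have uu' : u = u'.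
  by apply: independent_inj su su' _; [case: nH|move=> e; rewrite eu E -eu'].
subst u'; apply: (steps_deterministic lei_add leo_add st st').
  have [_ tF _] := leaf_path_facts p nH.
  exact: terminal_sub (support_set_sub sw) tF.
have [_ tF _] := leaf_path_facts p' nH.
exact: terminal_sub (support_set_sub sw') tF.
Qed.

Lemma full_leaves_exchange H T i j : reduction_tree rule H T -> nice R H ->
  let L := side_leaves T in let F k := nth finset.set0 L k in
  j < i -> i < size L -> exists r k,
    [/\ r \in F i, r \notin F j, k < i & F i :\ r \subset F k].
Proof.
move=> t nH L F ji lti; have [d [D p]] := side_leaves_path t lti.
have [|r [F' [rF rFj F'p sF]]] :=
  shelling_exchange lei_add leo_add nH p (Fj := F j).
  by rewrite -[F j](nth_take finset.set0 ji) mem_nth // size_take lti.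
exists r, (index F' (take i L)).
have lt : index F' (take i L) < i.
  by rewrite -[ltnRHS](@size_takel i _ L) ?index_mem // ltnW.
by split=> //; rewrite /F -(nth_take finset.set0 lt) nth_index.
Qed.

End FullLeaves.


(** * Leaf polytopes *)

Section IndexedHulls.
Variables (R : realFieldType) (V : lmodType R) (I : eqType) (f : I -> V).
Variable s : seq I.
Hypothesis f_inj : {in s &, injective f}.
Local Open Scope ring_scope.

(** In [conv] and [aff] the coefficients are functions of vectors; injectivity of [f] on [s] lets
    them be indexed by [I]. *)
Lemma pull_coefficients (c : I -> R) :
  exists c' : V -> R, forall k, k \in s -> c' (f k) = c k.
Proof.
elim: s f_inj => [|k0 s' IH] inj; first by exists (fun=> 0).
have [k k' ks ks'|c' c'P] := IH.
  by apply: inj; rewrite in_cons ?ks ?ks' orbT.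
exists (fun y => if y == f k0 then c k0 else c' y) => k ks.
case: eqVneq => [/inj->//|]; first exact: mem_head.
by move: ks; rewrite in_cons => /orP[/eqP->|/c'P->//]; rewrite eqxx.
Qed.

Lemma conv_mapP x : conv (map f s) x <->
  exists c : I -> R, [/\ forall k, k \in s -> 0 <= c k,
    \sum_(k <- s) c k = 1 & x = \sum_(k <- s) c k *: f k].
Proof.
split=> [[c [c0 c1 ->]]|[c [c0 c1 ->]]].
  exists (c \o f); split=> [k ks||] /=; first by rewrite c0 ?map_f.
    by rewrite -c1 big_map.
  by rewrite big_map.
have [c' c'P] := pull_coefficients c; exists c'; split.
- by move=> _ /mapP[k ks ->]; rewrite c'P // c0.
- by rewrite -c1 big_map; apply: eq_big_seq => k /c'P.
- by rewrite big_map; apply: eq_big_seq => k /c'P->.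
Qed.

Lemma aff_map (c : I -> R) : \sum_(k <- s) c k = 1 ->
  aff (map f s) (\sum_(k <- s) c k *: f k).
Proof.
move=> c1; have [c' c'P] := pull_coefficients c; exists c'.
split; first by rewrite -c1 big_map; apply: eq_big_seq => k /c'P.
by rewrite big_map; apply: eq_big_seq => k /c'P->.
Qed.

End IndexedHulls.

Lemma conv_perm (R : realFieldType) (V : lmodType R) (X Y : seq V) :
  perm_eq X Y -> conv X = conv Y.
Proof.
move=> XY; apply/seteqP; split=> x [c [c0 c1 ->]]; exists c.
  split; [|by rewrite -c1; apply/esym/perm_big|exact: perm_big].
  by move=> y; rewrite -(perm_mem XY); exact: c0.
split; [|by rewrite -c1; apply/perm_big|by apply/esym/perm_big].
by move=> y; rewrite (perm_mem XY); exact: c0.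
Qed.

(** * Leaf simplices in coordinates *)

Section LeafPolytopes.
Variables (n : nat) (G : multigraph n) (R : realFieldType).
Local Open Scope ring_scope.
Implicit Types (h r : hedge G) (F : node G) (w : hedge G -> R) (t : 'I_n -> R).
Local Notation V := (flow_space R (tilde G)).

Definition vertex (k : 'I_n + hedge G) : V :=
  unit_flow R (match k with inl i => trivial_route G i | inr h => route h end).

Definition vertex_indices F : seq ('I_n + hedge G) :=
  map inl (enum 'I_n) ++ map inr (enum F).

Lemma leaf_verticesE F : leaf_vertices R F = map vertex (vertex_indices F).
Proof.
by rewrite /vertex_indices map_cat -map_comp -[in RHS](map_comp _ inr).
Qed.

Lemma mem_vertex_indices F k :
  (k \in vertex_indices F) = if k is inr h then h \in F else true.
Proof.
rewrite mem_cat; case: k => [i|h].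
  by rewrite map_f ?mem_enum.
rewrite (mem_map inr_inj) mem_enum orbC.
by case: (h \in F) => //=; apply/negbTE/negP => /mapP[].
Qed.

Lemma uniq_vertex_indices F : uniq (vertex_indices F).
Proof.
rewrite cat_uniq (map_inj_uniq inl_inj) (map_inj_uniq inr_inj).
rewrite !enum_uniq andbT /=.
by apply/hasPn => _ /mapP[h _ ->]; apply/negP => /mapP[].
Qed.

Lemma unit_flow_inj (A B : {set edge (tilde G)}) :
  unit_flow R A = unit_flow R B -> A = B.
Proof.
move=> E; apply/setP => e; have := congr1 (fun f : V => f e) E.
rewrite !ffunE; do 2 case: (_ \in _) => //; move/eqP; rewrite ?oner_eq0 //.
by rewrite eq_sym oner_eq0.
Qed.

Lemma vertex_inj F : (forall h, h \in F -> path_like h) ->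
  {in vertex_indices F &, injective vertex}.
Proof.
move=> pF k k'; rewrite !mem_vertex_indices => kF k'F /unit_flow_inj/setP E.
have ne i h : h \in F -> trivial_route G i =i route h -> False.
  move=> hF {}E; have [lt _ _] := pF h hF.
  have := E (inl (inl i)); have := E (inl (inr i)); rewrite !inE !eqxx /=.
  by move=> /esym/eqP it /esym/eqP ih; rewrite -it -ih ltnn in lt.
case: k k' kF k'F E => [i|h] [i'|h'] kF k'F E.
- have := E (inl (inl i)); rewrite !inE eqxx /= orbF.
  by move=> /esym/eqP[->].
- by case: (ne i h' k'F).
- by case: (ne i' h kF) => e; rewrite E.
- congr inr; apply: hedge_eq.
  + by have := E (inl (inl (hsrc h))); rewrite !inE eqxx => /esym/eqP.
  + by have := E (inl (inr (htgt h))); rewrite !inE eqxx => /esym/eqP.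
  + by apply/setP => e; have := E (inr e); rewrite !inE.
Qed.

Definition flow_point t w : V := [ffun e : tilde_edge G => match e with
  | inl (inl i) => t i + \sum_(h | hsrc h == i) w h
  | inl (inr i) => t i + \sum_(h | htgt h == i) w h
  | inr e => eval w e end].

Lemma sum_vertex_indices (A : nmodType) F (c : 'I_n + hedge G -> A) :
  \sum_(k <- vertex_indices F) c k =
  \sum_i c (inl i) + \sum_(h in F) c (inr h).
Proof. by rewrite big_cat !big_map !big_enum. Qed.

Lemma sum_supp F w (P : pred (hedge G)) : supp_in w F ->
  \sum_(h in F) w h * (P h)%:R = \sum_(h | P h) w h.
Proof.
move=> sw; rewrite big_mkcond [RHS]big_mkcond; apply: eq_bigr => h _.
have [hF|/sw->] := boolP (h \in F); last by case: ifP.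
by case: ifP => _; rewrite ?mulr1 ?mulr0.
Qed.

Lemma sum_vertices F t w : supp_in w F ->
  \sum_(k <- vertex_indices F)
    (match k with inl i => t i | inr h => w h end) *: vertex k = flow_point t w.
Proof.
move=> sw; apply/ffunP => e; rewrite sum_ffunE ffunE sum_vertex_indices.
have T i0 (P : pred 'I_n) : P =1 pred1 i0 -> \sum_i t i * (P i)%:R = t i0.
  move=> PE; rewrite (bigD1 i0) //= PE /= eqxx mulr1 big1 ?addr0 // => i ne.
  by rewrite PE /= (negPf ne) mulr0.
have S i : (t i *: vertex (inl i)) e = t i * (e \in trivial_route G i)%:R.
  by rewrite !ffunE.
have S' h : (w h *: vertex (inr h)) e = w h * (e \in route h)%:R.
  by rewrite !ffunE.
under eq_bigr => i _ do rewrite S.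
under [X in _ + X]eq_bigr => h _ do rewrite S'.
rewrite sum_supp //; case: e S S' => [[i|i]|e] _ _.
- rewrite (T i) => [|i'] /=; last by rewrite !inE orbF eq_sym.
  by congr (_ + _); apply: eq_bigl => h; rewrite !inE eq_sym.
- rewrite (T i) => [|i'] /=; last by rewrite !inE /= eq_sym.
  by congr (_ + _); apply: eq_bigl => h; rewrite !inE eq_sym.
- rewrite big1 ?add0r => [|i _]; last by rewrite !inE mulr0.
  rewrite big_mkcond /=; apply: eq_bigr => h _; rewrite !inE.
  by case: (e \in _).
Qed.

Lemma leaf_polytopeP F p : (forall h, h \in F -> path_like h) ->
  leaf_polytope R F p <-> exists t w,
    [/\ forall i, 0 <= t i, nonneg w, supp_in w F,
        \sum_i t i + \sum_h w h = 1 & p = flow_point t w].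
Proof.
move=> pF; rewrite /leaf_polytope leaf_verticesE.
have sumF w : supp_in w F -> \sum_(h in F) w h = \sum_h w h.
  move=> sw; rewrite big_mkcond; apply: eq_bigr => h _.
  by case: ifPn => // /sw.
split=> [/(conv_mapP (vertex_inj pF))[c [c0 c1 ->]]|[t [w [t0 w0 sw s1 ->]]]].
  pose w h := if h \in F then c (inr h) else 0.
  have sw : supp_in w F by move=> h hF; rewrite /w (negPf hF).
  exists (fun i => c (inl i)), w; split=> //.
  - by move=> i; apply: c0; rewrite mem_vertex_indices.
  - move=> h; rewrite /w; case: ifP => // hF.
    by apply: c0; rewrite mem_vertex_indices.
  - rewrite -c1 sum_vertex_indices -(sumF _ sw); congr (_ + _).
    by apply: eq_bigr => h hF; rewrite /w hF.
  - rewrite -(sum_vertices _ sw); apply: eq_big_seq => -[i|h] //.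
    by rewrite mem_vertex_indices /w => ->.
apply/(conv_mapP (vertex_inj pF)).
exists (fun k => match k with inl i => t i | inr h => w h end); split.
- by case.
- by rewrite sum_vertex_indices sumF.
- by rewrite sum_vertices.
Qed.

Lemma flow_point_slack_inj t t' w : flow_point t w = flow_point t' w -> t = t'.
Proof.
move=> E; apply: funext => i; have := congr1 (fun f : V => f (inl (inl i))) E.
by rewrite !ffunE => /addIr.
Qed.

Lemma flow_point_eval t t' w w' :
  flow_point t w = flow_point t' w' -> eval w =1 eval w'.
Proof.
by move=> E e; have := congr1 (fun f : V => f (inr e)) E; rewrite !ffunE.
Qed.

(** A relation among the vertices restricts on [G] to a weight with zero flow, which vanishes by
    independence. The edges at [s] then isolate the coefficients of the trivial routes. *)
Lemma aff_indep_leaf F : nice R F -> aff_indep (leaf_vertices R F).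
Proof.
move=> [pF iF]; rewrite leaf_verticesE; split.
  by rewrite map_inj_in_uniq ?uniq_vertex_indices //; exact: vertex_inj.
move=> c c1 c0 _ /mapP[k kF ->].
pose w h := if h \in F then c (vertex (inr h)) else 0.
pose t i := c (vertex (inl i)).
have sw : supp_in w F by move=> h hF; rewrite /w (negPf hF).
have E : flow_point t w = flow_point (fun=> 0) (fun=> 0).
  have -> : flow_point t w = 0.
    rewrite -(sum_vertices _ sw) -[RHS]c0 big_map.
    apply: eq_big_seq => -[i|h] //.
    by rewrite mem_vertex_indices /w => ->.
  apply/ffunP => -[[i|i]|e]; rewrite !ffunE ?big1 ?addr0 //.
  by rewrite /eval big1 // => h _; rewrite mul0rn.
have w0 : w = fun=> 0.
  apply: (independent_inj iF) => //; exact: flow_point_eval E.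
rewrite w0 in E; have t0 := flow_point_slack_inj E.
case: k kF => [i|h] kF; first exact: (congr1 (fun f => f i) t0).
rewrite mem_vertex_indices in kF.
by have := congr1 (fun f => f h) w0; rewrite /w kF.
Qed.

End LeafPolytopes.

(** * Flows *)

Section FlowPolytope.
Variables (n : nat) (G : multigraph n) (R : realFieldType).
Local Open Scope ring_scope.
Implicit Types (h r : hedge G) (F : node G) (w : hedge G -> R) (t : 'I_n -> R).
Local Notation V := (flow_space R (tilde G)).

Lemma inner_inj : injective (@inner n).
Proof. by move=> i j /lift_inj/(congr1 val) /= /ord_inj. Qed.

Lemma inner_neq0 (i : 'I_n) : (inner i == ord0) = false.
Proof. by apply/negbTE; rewrite eq_sym neq_lift. Qed.

Lemma inner_neq_max (i : 'I_n) : (inner i == ord_max) = false.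
Proof.
apply/negbTE/eqP => /(congr1 val) /=; rewrite /bump /= add1n => -[E].
by have := ltn_ord i; rewrite E ltnn.
Qed.

Lemma inner_cases (v : 'I_n.+2) :
  [\/ v = ord0, v = ord_max | exists i, v = inner i].
Proof.
have [v0|v0] := eqVneq (v : nat) 0%N; first by constructor 1; apply: ord_inj.
have [vm|vm] := eqVneq (v : nat) n.+1; first by constructor 2; apply: ord_inj.
have lt : (v.-1 < n)%N by have := ltn_ord v; lia.
constructor 3; exists (Ordinal lt); apply: ord_inj; rewrite /= /bump /=.
lia.
Qed.

Lemma flow_polytopeP (f : V) : flow_polytope R (tilde G) f <->
  [/\ forall e, 0 <= f e, \sum_i f (inl (inl i)) = 1,
      \sum_i f (inl (inr i)) = 1 &
   forall i, f (inl (inl i)) + \sum_(e | tgt e == i) f (inr e) =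
             f (inl (inr i)) + \sum_(e | src e == i) f (inr e)].
Proof.
have N v : netflow f v =
    \sum_(i | ord0 == v) f (inl (inl i))
      + \sum_(i | inner i == v) f (inl (inr i))
      + \sum_(e | inner (src e) == v) f (inr e) -
   (\sum_(i | inner i == v) f (inl (inl i))
      + \sum_(i | ord_max == v) f (inl (inr i))
      + \sum_(e | inner (tgt e) == v) f (inr e)).
  by rewrite /netflow !big_sumType.
have Z0 (A : finType) (g : A -> 'I_n) (F : A -> R) :
    \sum_(x | inner (g x) == ord0) F x = 0.
  by rewrite big_pred0 // => x; exact: inner_neq0.
have Zm (A : finType) (g : A -> 'I_n) (F : A -> R) :
    \sum_(x | inner (g x) == ord_max) F x = 0.
  by rewrite big_pred0 // => x; exact: inner_neq_max.
have N0 : netflow f ord0 = \sum_i f (inl (inl i)).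
  by rewrite N !(Z0 _ id) !(Z0 _ (@src _ G)) !addr0 subr0 (eq_bigl xpredT).
have Nm : netflow f ord_max = - \sum_i f (inl (inr i)).
  have z1 : \sum_(i | ord0 == ord_max :> 'I_n.+2) f (inl (inl i)) = 0.
    by rewrite big_pred0.
  have z2 := Zm _ id (fun i => f (inl (inl i))).
  have z3 := Zm _ id (fun i => f (inl (inr i))).
  have z4 : \sum_(i | ord_max == ord_max :> 'I_n.+2) f (inl (inr i)) =
      \sum_i f (inl (inr i)).
    by apply: eq_bigl => i; rewrite eqxx.
  rewrite N (Zm _ (@src _ G)) (Zm _ (@tgt _ G)) z1 z2 z3 z4.
  by rewrite !addr0 !add0r.
have Ni i : netflow f (inner i) =
    f (inl (inr i)) + \sum_(e | src e == i) f (inr e)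
    - (f (inl (inl i)) + \sum_(e | tgt e == i) f (inr e)).
  rewrite N; have E (A : finType) (g : A -> 'I_n) (F : A -> R) :
      \sum_(x | inner (g x) == inner i) F x = \sum_(x | g x == i) F x.
    by apply: eq_bigl => x; rewrite (inj_eq inner_inj).
  have z0 : \sum_(j | ord0 == inner i) f (inl (inl j)) = 0.
    by rewrite big_pred0 // => j; rewrite eq_sym inner_neq0.
  have zm : \sum_(j | ord_max == inner i) f (inl (inr j)) = 0.
    by rewrite big_pred0 // => j; rewrite eq_sym inner_neq_max.
  rewrite z0 zm !(E _ id) (E _ (@src _ G)) (E _ (@tgt _ G)) !big_pred1_eq.
  by rewrite add0r addr0.
have m0 : (ord_max == ord0 :> 'I_n.+2) = false by [].
split=> [[f0 fv]|[f0 s0 sm fi]].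
  split=> //.
  - by rewrite -N0 fv eqxx eq_sym m0 subr0.
  - by apply: oppr_inj; rewrite -Nm fv m0 eqxx sub0r.
  - move=> i; have := Ni i; rewrite fv inner_neq0 inner_neq_max subr0.
    by move=> /esym/subr0_eq.
split=> // v; case: (inner_cases v) => [->|->|[i ->]].
- by rewrite N0 s0 eqxx eq_sym m0 subr0.
- by rewrite Nm sm m0 eqxx sub0r.
- by rewrite Ni -fi subrr inner_neq0 inner_neq_max subr0.
Qed.

(** The balance clause of [path_like], multiplied by [w h] and summed over [h]. *)
Lemma boundary_eval F w i : (forall h, h \in F -> path_like h) -> supp_in w F ->
  \sum_(h | hsrc h == i) w h + \sum_(e | tgt e == i) eval w e =
  \sum_(h | htgt h == i) w h + \sum_(e | src e == i) eval w e.
Proof.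
move=> pF sw.
have S (g : edge G -> 'I_n) : \sum_(e | g e == i) eval w e =
    \sum_h w h *+ (\sum_(e in hsum h) (g e == i)).
  rewrite exchange_big /=; apply: eq_bigr => h _.
  rewrite -sumrMnr [LHS]big_mkcond [RHS]big_mkcond /=; apply: eq_bigr => e _.
  by case: (g e == i); case: (e \in hsum h).
rewrite !S [X in X + _ = _]big_mkcond [X in _ = X + _]big_mkcond -!big_split /=.
apply: eq_bigr => h _; have [hF|/sw->] := boolP (h \in F); last first.
  by rewrite !mul0rn !if_same.
have [_ _ /(_ i) E] := pF h hF.
have -> (b : bool) : (if b then w h else 0) = w h *+ b by case: b.
have -> (b : bool) : (if b then w h else 0) = w h *+ b by case: b.
by rewrite -!mulrnDr addnC -E addnC.
Qed.

Lemma sum_partition (g : hedge G -> 'I_n) w :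
  \sum_i \sum_(h | g h == i) w h = \sum_h w h.
Proof. by rewrite [RHS](partition_big g xpredT). Qed.

Lemma leaf_polytope_sub F : (forall h, h \in F -> path_like h) ->
  (leaf_polytope R F `<=` flow_polytope R (tilde G))%classic.
Proof.
move=> pF p /(leaf_polytopeP _ pF)[t [w [t0 w0 sw s1 ->]]].
apply/flow_polytopeP; split.
- case=> [[i|i]|e]; rewrite ffunE ?addr_ge0 ?sumr_ge0 //.
  by move=> h _; rewrite mulrn_wge0.
- by under eq_bigr do rewrite ffunE; rewrite big_split sum_partition.
- by under eq_bigr do rewrite ffunE; rewrite big_split sum_partition.
- move=> i; have S (g : edge G -> 'I_n) :
      \sum_(e | g e == i) flow_point t w (inr e) = \sum_(e | g e == i) eval w e.
    by apply: eq_bigr => e _; rewrite ffunE.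
  rewrite (S (@src _ G)) (S (@tgt _ G)) !ffunE -!addrA.
  by rewrite (boundary_eval _ pF sw).
Qed.

(** The only possible coefficient of the trivial route at [i] when the routes of [w] are taken out
    of [f]. *)
Definition slack (f : V) w (i : 'I_n) : R :=
  f (inl (inl i)) - \sum_(h | hsrc h == i) w h.

Lemma flow_slack F f w : (forall h, h \in F -> path_like h) -> supp_in w F ->
  flow_polytope R (tilde G) f -> eval w =1 (fun e => f (inr e)) ->
  [/\ f = flow_point (slack f w) w, \sum_i slack f w i + \sum_h w h = 1 &
      forall i, slack f w i = f (inl (inr i)) - \sum_(h | htgt h == i) w h].
Proof.
move=> pF sw /flow_polytopeP[f0 fs ft fi] ew.
have st i : slack f w i = f (inl (inr i)) - \sum_(h | htgt h == i) w h.
  have S (g : edge G -> 'I_n) :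
      \sum_(e | g e == i) eval w e = \sum_(e | g e == i) f (inr e).
    by apply: eq_bigr => e _; rewrite ew.
  have := boundary_eval i pF sw; have := fi i.
  by rewrite (S (@src _ G)) (S (@tgt _ G)) /slack; lra.
split=> //.
- apply/ffunP => -[[i|i]|e]; rewrite ffunE ?ew //.
    by rewrite subrK.
  by rewrite st subrK.
- by rewrite sumrB fs sum_partition subrK.
Qed.

(** In a terminal node no vertex is both a source and a target of edges. So the sum vanishes in one
    of the two expressions for the slack, and a coordinate of [f] remains. *)
Lemma slack_ge0 F f w i : (forall h, h \in F -> path_like h) -> terminal F ->
  supp_in w F -> flow_polytope R (tilde G) f ->
  eval w =1 (fun e => f (inr e)) -> 0 <= slack f w i.
Proof.
move=> pF tF sw Pf ew; have [_ _ st] := flow_slack pF sw Pf ew.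
have [f0 _ _ _] := (flow_polytopeP f).1 Pf.
have [/existsP[b /andP[bF /eqP sb]]|nb] :=
    boolP [exists b, (b \in F) && (hsrc b == i)].
  rewrite st big1 ?subr0 // => a /eqP ta; apply: sw; apply/negP => aF.
  have [la _ _] := pF a aF; have [lb _ _] := pF b bF.
  have /negP[] := tF a b; apply/and5P; split=> //.
  by rewrite ta sb.
rewrite /slack big1 ?subr0 // => b sb; apply: sw; apply: contra nb => bF.
by apply/existsP; exists b; rewrite bF.
Qed.

End FlowPolytope.


(** * Triangulation and shelling *)

Section CanonicalTriangulation.
Variables (n : nat) (G : multigraph n) (R : realFieldType).
Variables (lei leo : rel {set edge G}) (T : rtree G).
Hypotheses (lei_add : additive_order lei) (leo_add : additive_order leo).
Hypothesis T_red : reduction_treeO lei leo T.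
Local Open Scope ring_scope.
Local Open Scope classical_set_scope.
Implicit Types (h r : hedge G) (F : node G) (w : hedge G -> R) (t : 'I_n -> R).
Local Notation L := (side_leaves T).
Local Notation P := (flow_polytope R (tilde G)).

Let nR : nice R (root_node G) := nice_root G R.

Lemma side_leaf_nice F : F \in L -> nice R F /\ terminal F.
Proof.
move=> /(mem_side_leaves_path T_red)[d [pre [D p]]].
by have [nF tF _] := leaf_path_facts p nR.
Qed.

Lemma root_weight_eval (f : flow_space R (tilde G)) e :
  eval (root_weight (fun e => f (inr e))) e = f (inr e).
Proof. by rewrite eval_root ?root_weightE //; exact: root_weight_supp. Qed.

Lemma flow_in_leaf f : P f -> exists2 F, F \in L & leaf_polytope R F f.
Proof.
move=> Pf; have [f0 _ _ _] := (flow_polytopeP f).1 Pf.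
have [|F [w [FL sw w0 ew _]]] := side_leaves_cover T_red nR
    (root_weight_supp (fun e => f (inr e))).
  by move=> h; rewrite /root_weight sumr_ge0 // => e _; rewrite mulrn_wge0.
have [[pF _] tF] := side_leaf_nice FL.
have ewf : eval w =1 (fun e => f (inr e)).
  by move=> e; rewrite ew root_weight_eval.
have [E s1 _] := flow_slack pF sw Pf ewf.
exists F => //; apply/leaf_polytopeP => //; exists (slack f w), w; split=> //.
by move=> i; exact: slack_ge0 tF sw Pf ewf.
Qed.

Lemma flow_in_aff F : F \in L -> P `<=` aff (leaf_vertices R F).
Proof.
move=> FL f Pf; have [[pF _] _] := side_leaf_nice FL.
have [d [pre [D p]]] := mem_side_leaves_path T_red FL.
have [w sw ew] := leaf_path_signed p nR (root_weight_supp (fun e => f (inr e))).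
have ewf : eval w =1 (fun e => f (inr e)).
  by move=> e; rewrite ew root_weight_eval.
have [E s1 _] := flow_slack pF sw Pf ewf.
rewrite E -(sum_vertices _ sw) leaf_verticesE.
apply: (aff_map (vertex_inj pF)); rewrite sum_vertex_indices -[RHS]s1.
congr (_ + _); rewrite big_mkcond; apply: eq_bigr => h _.
by case: ifPn => // /sw.
Qed.

(** A common point induces the same flow on [G] from both leaves, so its two weights agree by
    [side_leaves_unique] and live on the common edges. *)
Lemma leaf_polytopeI F F' : F \in L -> F' \in L ->
  leaf_polytope R F `&` leaf_polytope R F' = leaf_polytope R (F :&: F')%SET.
Proof.
move=> FL F'L; have [[pF _] _] := side_leaf_nice FL.
have [[pF' _] _] := side_leaf_nice F'L.
have pI h : h \in (F :&: F')%SET -> path_like h by rewrite inE => /andP[/pF].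
apply/seteqP; split=> p.
  move=> [/(leaf_polytopeP _ pF)[t [w [t0 w0 sw s1 ->]]]].
  move=> /(leaf_polytopeP _ pF')[t' [w' [_ w0' sw' _ E]]].
  have ww' := side_leaves_unique lei_add leo_add T_red nR FL F'L
    sw sw' w0 w0' (flow_point_eval E).
  apply/(leaf_polytopeP _ pI); exists t, w; split=> //.
  move=> h; rewrite inE negb_and => /orP[/sw//|hF']; by rewrite ww' sw'.
move=> /(leaf_polytopeP _ pI)[t [w [t0 w0 sw s1 ->]]]; split.
  apply/(leaf_polytopeP _ pF); exists t, w; split=> //.
  by apply: supp_in_sub sw; exact: finset.subsetIl.
apply/(leaf_polytopeP _ pF'); exists t, w; split=> //.
by apply: supp_in_sub sw; exact: finset.subsetIr.
Qed.

Lemma leaf_polytope_mono F F' : (forall h, h \in F' -> path_like h) ->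
  F \subset F' -> leaf_polytope R F `<=` leaf_polytope R F'.
Proof.
move=> pF' sF p.
have pF h : h \in F -> path_like h by move=> /(fintype.subsetP sF)/pF'.
move=> /(leaf_polytopeP _ pF)[t [w [t0 w0 sw s1 ->]]].
by apply/(leaf_polytopeP _ pF'); exists t, w; split=> //; apply: supp_in_sub sw.
Qed.

Lemma leaf_vertices_sub F F' : F \subset F' ->
  {subset leaf_vertices R F <= leaf_vertices R F'}.
Proof.
move=> sF y; rewrite !leaf_verticesE => /mapP[k kF ->]; apply: map_f.
move: kF; rewrite !mem_vertex_indices; case: k => // h.
exact: (fintype.subsetP sF).
Qed.

Lemma leaf_vertices_setD1 F r : (forall h, h \in F -> path_like h) -> r \in F ->
  perm_eq (rem (vertex R (inr r)) (leaf_vertices R F))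
    (leaf_vertices R (F :\ r)).
Proof.
move=> pF rF.
have pF' h : h \in F :\ r -> path_like h by rewrite inE => /andP[_ /pF].
have uF F' : (forall h, h \in F' -> path_like h) -> uniq (leaf_vertices R F').
  move=> pX; rewrite leaf_verticesE map_inj_in_uniq ?uniq_vertex_indices //.
  exact: vertex_inj.
apply: uniq_perm; rewrite ?rem_uniq ?uF // => y.
rewrite (mem_rem_uniq _ (uF _ pF)) !inE !leaf_verticesE.
apply/andP/mapP => [[ne /mapP[k kF E]]|[k kF ->]].
  exists k => //; move: kF ne; rewrite !mem_vertex_indices E.
  case: k E => // h _ hF; rewrite !inE hF andbT.
  by apply: contraNneq => ->.
have kF' : k \in vertex_indices F.
  move: kF; rewrite !mem_vertex_indices; case: k => // h.
  by rewrite inE => /andP[].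
split; last exact: map_f.
apply: contraTneq kF => /(vertex_inj pF) -> //.
  by rewrite mem_vertex_indices !inE eqxx.
by rewrite mem_vertex_indices.
Qed.

Lemma leaf_polytope_facet F r : nice R F -> r \in F ->
  facet_of (leaf_polytope R (F :\ r)) (leaf_polytope R F).
Proof.
move=> nF rF; exists (leaf_vertices R F), (vertex R (inr r)); split=> //.
- exact: aff_indep_leaf.
- by rewrite leaf_verticesE map_f // mem_vertex_indices.
- by apply/esym/conv_perm/leaf_vertices_setD1 => //; case: nF.
Qed.

(** The unit flow along the route of [r] lies in both simplices, and by uniqueness its weight on
    [F'] is again the unit weight on [r]. So a simplex determines its leaf. *)
Lemma leaf_vertex_mem F F' r : F \in L -> F' \in L -> r \in F ->
  leaf_polytope R F = leaf_polytope R F' -> r \in F'.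
Proof.
move=> FL F'L rF E.
have [[pF _] _] := side_leaf_nice FL; have [[pF' _] _] := side_leaf_nice F'L.
have sr : supp_in (delta R [set r]%SET) F.
  by apply: delta_supp; rewrite finset.sub1set.
have : leaf_polytope R F (flow_point (fun=> 0) (delta R [set r]%SET)).
  apply/(leaf_polytopeP _ pF); exists (fun=> 0), (delta R [set r]%SET).
  split=> //.
  rewrite big1 // add0r (bigD1 r) //= /delta inE eqxx big1 ?addr0 // => h.
  by rewrite inE => /negPf->.
rewrite E => /(leaf_polytopeP _ pF')[t [w [_ w0 sw _ Ep]]].
have ww := side_leaves_unique lei_add leo_add T_red nR FL F'L sr sw
  (@delta_nonneg _ _ R _) w0 (flow_point_eval Ep).
apply: contraTT isT => /sw; rewrite -ww /delta inE eqxx => /eqP.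
by rewrite oner_eq0.
Qed.

Lemma full_leavesE : full_leaves T = L.
Proof. by rewrite /full_leaves -card_root_node (side_leaves_full T_red nR). Qed.

Let S := [seq leaf_polytope R H | H <- L].
Let F i := nth finset.set0 L i.

Let nthS i : (i < size L)%N -> nth set0 S i = leaf_polytope R (F i).
Proof. by move=> lt; rewrite (nth_map finset.set0). Qed.

Let exch i j : (j < i)%N -> (i < size L)%N -> exists r k,
  [/\ r \in F i, r \notin F j, (k < i)%N & F i :\ r \subset F k].
Proof. exact: (full_leaves_exchange lei_add leo_add T_red nR). Qed.

Lemma canonical_triangulation : triangulation P S.
Proof.
have sS : size S = size L by rewrite size_map.
rewrite /triangulation /= sS; split.
- move=> i lti; have FL : F i \in L by exact: mem_nth.
  have [nF _] := side_leaf_nice FL.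
  exists (leaf_vertices R (F i)); split.
  + exact: aff_indep_leaf.
  + exact: nthS.
  + exact: flow_in_aff.
- apply/seteqP; split=> [f /flow_in_leaf[X XL Xf]|f [i /= lti]].
    have lti : (index X L < size L)%N by rewrite index_mem.
    by exists (index X L) => //=; rewrite nthS // /F nth_index.
  rewrite nthS //; apply: leaf_polytope_sub.
  by have [[]] := side_leaf_nice (mem_nth _ lti : F i \in L).
- move=> i j lti ltj ij; rewrite !nthS //.
  have iL : F i \in L by exact: mem_nth.
  have jL : F j \in L by exact: mem_nth.
  rewrite (leaf_polytopeI iL jL).
  have [ni _] := side_leaf_nice iL; have [nj _] := side_leaf_nice jL.
  split.
  (* The exchange property provides an edge of the later leaf that the earlier one lacks. *)
  + move=> E; case: (ltngtP i j) ij => // [lt|lt] _.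
      have [r [k [rF rN _ _]]] := exch lt ltj; case/negP: rN.
      exact: leaf_vertex_mem jL iL rF (esym E).
    have [r [k [rF rN _ _]]] := exch lt lti; case/negP: rN.
    exact: leaf_vertex_mem iL jL rF E.
  + exists (leaf_vertices R (F i)), (leaf_vertices R (F i :&: F j)%SET).
    split=> //.
      exact: aff_indep_leaf.
    exact/leaf_vertices_sub/finset.subsetIl.
  + exists (leaf_vertices R (F j)), (leaf_vertices R (F i :&: F j)%SET).
    split=> //.
      exact: aff_indep_leaf.
    exact/leaf_vertices_sub/finset.subsetIr.
Qed.

(** Trivial routes are vertices of every leaf simplex, so there is a point even if [X] has no
    edges. *)
Lemma leaf_polytope_nonempty (X : node G) (i : 'I_n) :
  (forall h, h \in X -> path_like h) -> leaf_polytope R X !=set0.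
Proof.
move=> pX; exists (flow_point (fun j => (j == i)%:R) (fun=> 0)).
apply/(leaf_polytopeP _ pX).
exists (fun j => (j == i)%:R), (fun=> 0); split=> //.
rewrite [X in _ + X]big1 // addr0 (bigD1 i) //= eqxx big1 ?addr0 // => j.
by move=> /negPf->.
Qed.

Lemma canonical_shelling : shelling_order P S.
Proof.
split; first exact: canonical_triangulation.
have sS : size S = size L by rewrite size_map.
move=> i /= /andP[i0]; rewrite sS => lti.
have iL : F i \in L by exact: mem_nth.
have [ni _] := side_leaf_nice iL; have [pi _] := ni.
have facet_in r k : (k < i)%N -> F i :\ r \subset F k ->
    leaf_polytope R (F i :\ r) `<=`
    nth set0 S i `&` \bigcup_(j < i) nth set0 S j.
  move=> ki sF p pr; have ltk := ltn_trans ki lti.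
  have kL : F k \in L by exact: mem_nth.
  have [[pk _] _] := side_leaf_nice kL.
  split.
    rewrite nthS //; apply: leaf_polytope_mono pr => //.
    exact: finset.subD1set.
  by exists k => //=; rewrite nthS //; apply: leaf_polytope_mono pr.
split.
  have [r [k [rF _ ki sF]]] := exch i0 lti.
  have [|p pr] := @leaf_polytope_nonempty (F i :\ r) (hsrc r).
    by move=> h; rewrite inE => /andP[_ /pi].
  by exists p; apply: facet_in ki sF _ pr.
exists [set X | exists r k, [/\ r \in F i, (k < i)%N, F i :\ r \subset F k &
                               X = leaf_polytope R (F i :\ r)]].
  move=> X [r [k [rF _ _ ->]]]; rewrite nthS //.
  exact: leaf_polytope_facet.
apply/seteqP.
split=> [p [pi' [j /= ji pj]]|p [X [r [k [_ ki sF ->]]]]]; last first.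
  exact: facet_in ki sF _.
have ltj := ltn_trans ji lti.
have jL : F j \in L by exact: mem_nth.
(* A point of the simplices [i] and [j] has no weight on [r], as [r] is not in [F j]; so it lies in
   the facet opposite to [r]. *)
have [r [k [rF rFj ki sF]]] := exch ji lti.
exists (leaf_polytope R (F i :\ r)); first by exists r, k.
have : leaf_polytope R (F i :&: F j)%SET p.
  by rewrite -(leaf_polytopeI iL jL); rewrite !nthS // in pi' pj *.
apply: leaf_polytope_mono.
  by move=> h; rewrite inE => /andP[_ /pi].
apply/fintype.subsetP => h; rewrite !inE => /andP[-> hj]; rewrite andbT.
by apply: contraNneq rFj => <-.
Qed.

End CanonicalTriangulation.

Theorem theorem3 (R : realFieldType) (n : nat) (G : multigraph n)
    (lei leo : rel {set edge G}) (T : rtree G)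
    (lei_add : additive_order lei) (leo_add : additive_order leo)
    (T_red : reduction_treeO lei leo T) :
  shelling_order (flow_polytope R (tilde G))
    [seq leaf_polytope R H | H <- full_leaves T].
Proof. by rewrite (full_leavesE R T_red); exact: canonical_shelling T_red. Qed.
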